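(* If $X$ is a nonzero separable real Banach space with the Daugavet property, then $X$ does not embed into an unconditional sum of reflexive spaces. In particular, $X$ does not embed into a space with an unconditional basis.
   Context: A Banach space $X$ has the Daugavet property if $\|\mathrm{Id}+T\|=1+\|T\|$ for every bounded linear operator $T\colon X\to X$ of rank $1$. ''$X$ embeds into $Y$'' means that $X$ is isomorphic to a closed subspace of $Y$. A Banach space $Y$ is an unconditional sum of Banach spaces $X_n$, $n\in\mathbb{N}$ (an unconditional Schauder decomposition, written $Y=\bigoplus_n X_n$), if the $X_n$ are closed subspaces of $Y$ such that every $y\in Y$ has a unique representation $y=\sum_{n=1}^\infty x_n$ with $x_n\in X_n$, and this series converges unconditionally; the associated projections $P_n\colon Y\to X_n$, $y\mapsto x_n$, are then bounded. *)

(* Defs.v *)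
From HB Require Import structures.
From mathcomp Require Import all_boot all_order all_algebra.
From mathcomp Require Import all_classical all_reals all_analysis.

Set Implicit Arguments.
Unset Strict Implicit.
Unset Printing Implicit Defensive.

Import Order.TTheory GRing.Theory Num.Theory.
Import numFieldNormedType.Exports.

Local Open Scope classical_set_scope.
Local Open Scope ring_scope.

(* The supremum is only meaningful for a continuous linear f: on unbounded
   sets, sup takes the default value 0. *)
Definition opnorm (R : realType) (V W : normedModType R) (f : V -> W) : R :=
  sup [set `|f x| | x in [set x | `|x| <= 1]].

Section opnorm_theory.
Context {R : realType} {V W : normedModType R}.
Implicit Types f : {linear V -> W}.

Lemma opnorm_has_sup f : continuous f ->
  has_sup [set `|f x| | x in [set x : V | `|x| <= 1]].
Proof.
move=> cf; split.
  by exists `|f 0|, 0 => //=; rewrite normr0 ler01.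
have /bounded_funP/(_ 1)[M hM] := (linear_bounded_continuous f).2 cf.
by exists M => _ [x /= x1 <-]; exact: hM.
Qed.

Lemma opnorm_ub f x : continuous f -> `|x| <= 1 -> `|f x| <= opnorm f.
Proof.
by move=> cf x1; apply: sup_upper_bound; [exact: opnorm_has_sup|exists x].
Qed.

Lemma opnorm_le f c : (forall x, `|x| <= 1 -> `|f x| <= c) -> opnorm f <= c.
Proof.
move=> h; apply: ge_sup; first by exists `|f 0|, 0 => //=; rewrite normr0 ler01.
by move=> _ [x /= x1 <-]; exact: h.
Qed.

Lemma ler_opnorm f x : continuous f -> `|f x| <= opnorm f * `|x|.
Proof.
move=> cf; have [->|x0] := eqVneq x 0; first by rewrite raddf0 !normr0 mulr0.
rewrite -ler_pdivrMr ?normr_gt0// mulrC.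
have -> : `|x|^-1 * `|f x| = `|f (`|x|^-1 *: x)|.
  by rewrite linearZ/= normrZ normfV normr_id.
by apply: opnorm_ub => //; rewrite normrZ normfV normr_id mulVf// normr_eq0.
Qed.

End opnorm_theory.

Section dual.
Context {R : realType}.

Definition dual_pred (X : normedModType R) : {pred X -> R^o} :=
  mem [set f : X -> R^o | linear f /\ continuous f].
Arguments dual_pred X : clear implicits.

Lemma dual_submod_closed (X : normedModType R) : submod_closed (dual_pred X).
Proof.
split=> [|a f g].
  apply/mem_set; split=> [b x y|x]; last exact: cvg_cst.
  by rewrite /= scaler0 addr0.
move=> /set_mem[lf cf] /set_mem[lg cg]; apply/mem_set; split=> [b x y|x].
  rewrite /= !fctE /= lf lg /= !scalerDr !scalerA (mulrC a b).
  by rewrite -!addrA; congr (_ + _); rewrite addrCA.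
by apply: cvgD; [apply: cvgZr; exact: cf|exact: cg].
Qed.

HB.instance Definition _ (X : normedModType R) :=
  GRing.isSubmodClosed.Build R (X -> R^o) (dual_pred X)
    (dual_submod_closed X).

Record dual (X : normedModType R) := Dual {
  dual_fun :> X -> R^o;
  dual_funP : dual_fun \in dual_pred X
}.

HB.instance Definition _ (X : normedModType R) :=
  [isSub of dual X for @dual_fun X].
HB.instance Definition _ (X : normedModType R) := [Choice of dual X by <:].
HB.instance Definition _ (X : normedModType R) :=
  [SubChoice_isSubLmodule of dual X by <:].

Lemma dual_linear (X : normedModType R) (f : dual X) : linear f.
Proof. by have /set_mem[] := dual_funP f. Qed.

Lemma dual_continuous (X : normedModType R) (f : dual X) : continuous f.
Proof. by have /set_mem[] := dual_funP f. Qed.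

HB.instance Definition _ (X : normedModType R) (f : dual X) :=
  GRing.isLinear.Build R X R^o _ f (dual_linear f).

Let dual_norm (X : normedModType R) (f : dual X) : R := opnorm f.

Let dual_normD (X : normedModType R) (f g : dual X) :
  dual_norm (f + g) <= dual_norm f + dual_norm g.
Proof.
apply: opnorm_le => x x1; apply: le_trans (ler_normD _ _) _.
by apply: lerD; apply: opnorm_ub => //; exact: dual_continuous.
Qed.

Let dual_normZ_le (X : normedModType R) (l : R) (f : dual X) :
  dual_norm (l *: f) <= `|l| * dual_norm f.
Proof.
apply: opnorm_le => x x1; rewrite [leLHS](_ : _ = `|l| * `|f x|).
  by apply: ler_wpM2l => //; apply: opnorm_ub => //; exact: dual_continuous.
by rewrite -normrM.
Qed.

Let dual_normZ (X : normedModType R) (l : R) (f : dual X) :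
  dual_norm (l *: f) = `|l| * dual_norm f.
Proof.
apply/eqP; rewrite eq_le dual_normZ_le/=; have [->|l0] := eqVneq l 0.
  rewrite normr0 mul0r; apply: le_trans (opnorm_ub (x := 0) _ _) => //.
    exact: dual_continuous.
  by rewrite normr0 ler01.
rewrite -ler_pdivlMl ?normr_gt0// -normfV.
apply: le_trans (dual_normZ_le _ _).
by rewrite scalerA mulVf// scale1r.
Qed.

Let dual_norm_eq0 (X : normedModType R) (f : dual X) :
  dual_norm f = 0 -> f = 0.
Proof.
move=> f0; apply/val_inj/funext => x /=; apply/eqP; rewrite -normr_le0.
apply: le_trans (ler_opnorm x (@dual_continuous _ f)) _.
by rewrite [opnorm _]f0 mul0r.
Qed.

HB.instance Definition _ (X : normedModType R) :=
  Lmodule_isNormed.Build R (dual X)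
    (@dual_normD X) (@dual_normZ X) (@dual_norm_eq0 X).

Lemma dual_normE (X : normedModType R) (f : dual X) : `|f| = opnorm f.
Proof. by []. Qed.

Lemma bidual_subproof (X : normedModType R) (x : X) :
  (fun f : dual X => f x) \in dual_pred (dual X).
Proof.
have l : linear (fun f : dual X => f x : R^o) by [].
apply/mem_set; split => //.
pose e : {linear dual X -> R^o} :=
  HB.pack (fun f : dual X => f x : R^o) (GRing.isLinear.Build _ _ _ _ _ l).
apply: (@bounded_linear_continuous _ _ _ e); apply/bounded_funP => r.
exists (r * `|x|) => f fr.
apply: le_trans (ler_opnorm x (@dual_continuous _ f)) _.
by apply: ler_wpM2r => //; rewrite -dual_normE.
Qed.

Definition to_bidual (X : normedModType R) (x : X) : dual (dual X) :=
  Dual (bidual_subproof x).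

Definition reflexive_space (X : normedModType R) :=
  range (@to_bidual X) = setT.

End dual.

Section closed_subspace.
Context {R : realType}.

Record closedSubspace (Y : normedModType R) := ClosedSubspace {
  csub_set : set Y;
  csub_submod : submod_closed (mem csub_set);
  csub_closed : closed csub_set
}.

Definition csub_pred (Y : normedModType R) (V : closedSubspace Y) : {pred Y} :=
  mem (csub_set V).

HB.instance Definition _ (Y : normedModType R) (V : closedSubspace Y) :=
  GRing.isSubmodClosed.Build R Y (csub_pred V) (csub_submod V).

(* set_type already carries the topology induced by its inclusion, so the
   normed space V gets a carrier of its own. *)
Record csub (Y : normedModType R) (V : closedSubspace Y) := CSub {
  csub_val : Y;
  csub_valP : csub_val \in csub_pred V
}.

HB.instance Definition _ (Y : normedModType R) (V : closedSubspace Y) :=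
  [isSub of csub V for @csub_val Y V].
HB.instance Definition _ (Y : normedModType R) (V : closedSubspace Y) :=
  [Choice of csub V by <:].
HB.instance Definition _ (Y : normedModType R) (V : closedSubspace Y) :=
  [SubChoice_isSubLmodule of csub V by <:].

Let csub_normD (Y : normedModType R) (V : closedSubspace Y) (u v : csub V) :
  `|val (u + v)| <= `|val u| + `|val v|.
Proof. exact: ler_normD. Qed.

Let csub_normZ (Y : normedModType R) (V : closedSubspace Y) (l : R)
  (u : csub V) : `|val (l *: u)| = `|l| * `|val u|.
Proof. exact: normrZ. Qed.

Let csub_norm_eq0 (Y : normedModType R) (V : closedSubspace Y) (u : csub V) :
  `|val u| = 0 -> u = 0.
Proof. by move/normr0_eq0 => u0; exact: val_inj. Qed.

HB.instance Definition _ (Y : normedModType R) (V : closedSubspace Y) :=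
  Lmodule_isNormed.Build R (csub V)
    (@csub_normD Y V) (@csub_normZ Y V) (@csub_norm_eq0 Y V).

Lemma csub_normE (Y : normedModType R) (V : closedSubspace Y) (u : csub V) :
  `|u| = `|val u|.
Proof. by []. Qed.

End closed_subspace.

Definition separable_space (T : topologicalType) :=
  exists2 A : set T, countable A & dense A.

Section banach_notions.
Context {R : realType}.

Definition rank_one (V W : normedModType R) (T : V -> W) :=
  exists2 w : W, w != 0 & range T = [set a *: w | a in [set: R]].

Definition Daugavet (X : normedModType R) :=
  forall T : {linear X -> X}, continuous T -> rank_one T ->
    opnorm (fun x => x + T x) = 1 + opnorm T.

Definition isomorphic (X Z : normedModType R) :=
  exists (T : {linear X -> Z}) (S : {linear Z -> X}),
    [/\ cancel T S, cancel S T, continuous T & continuous S].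

Definition embeds (X Y : normedModType R) :=
  exists V : closedSubspace Y, isomorphic X (csub V).

Definition unconditionally_cvg (Y : normedModType R) (x : nat -> Y) :=
  forall s : nat -> nat, bijective s -> cvgn (series (x \o s)).

Definition unconditional_sum (Y : normedModType R)
    (X_ : nat -> closedSubspace Y) :=
  (forall y : Y, exists! x : nat -> Y,
    (forall n, csub_set (X_ n) (x n)) /\ series x @ \oo --> y) /\
  (forall x : nat -> Y, (forall n, csub_set (X_ n) (x n)) ->
    cvgn (series x) -> unconditionally_cvg x).

Definition unconditional_basis (Y : normedModType R) (e : nat -> Y) :=
  (forall y : Y, exists! a : nat -> R,
    series (fun n => a n *: e n) @ \oo --> y) /\
  (forall a : nat -> R, cvgn (series (fun n => a n *: e n)) ->
    unconditionally_cvg (fun n => a n *: e n)).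

End banach_notions.

(* Main.v *)
Require Import Defs.
From HB Require Import structures.
From mathcomp Require Import all_boot all_order all_algebra.
From mathcomp Require Import all_classical all_reals all_analysis.
From mathcomp Require Import ring lra.
Import Order.TTheory GRing.Theory Num.Theory.
Import numFieldNormedType.Exports.
Local Open Scope classical_set_scope.
Local Open Scope ring_scope.
Set Implicit Arguments.
Unset Strict Implicit.
Unset Printing Implicit Defensive.

(** An isomorphic embedding [J] of [X] into an unconditional sum of reflexive
    spaces is refuted by a gliding hump.  Let [P_A] be the projection onto the
    components in a finite set [A] of indices; these projections are bounded by
    a common constant [C].  Suppose that for every [y] in the unit ball of [X],
    every [u] in [X] and every finite [A] there is [z] in the unit ball with
    [P_A (J z)] close to [P_A (J y)] and [`|u + z|] close to [`|u| + 1].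
    Starting from [y_0], choose such points [y_1, y_2] and so on, with [A] an
    ever longer initial segment of the indices: the images of the increments
    [y_(j+1) - y_j] are almost disjoint blocks, and the sum [s] of every second
    increment has norm of the order of the number of steps.  But [J s] is nearly
    [P_A (J (y_k - y_0))] for the union [A] of the retained blocks, which has
    norm at most [2 * C] times the norm of [J].  Hence [J] is not bounded below
    ([no_unconditional_embedding]).

    The points [z] exist because [P_A J] is a weakly compact operator [T]
    ([weakly_compact_reflexive], [weakly_compact_narrow]). Call [p]
    attainable if for each [u] it is approximated by [T z] with [z] in the
    unit ball and [`|u + z|] close to [`|u| + 1]. Attainable points form a
    closed convex set; if it missed some [T y] with [y] in the ball, a
    functional would separate it strictly from [T y], hence from the image
    of a slice of the ball containing [y]; but every slice provides an
    attainable point in the closed convex hull of its image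
    ([ex_attainable_slice]). The Daugavet property allows every slice to be
    shrunk until all its points [z] are almost additive to a given [u]
    ([subslice_almost_additive1]). By separability this gives a sequence in
    the slice whose late convex combinations are almost additive to every
    [u] ([ex_almost_additive_seq]), and the weak limit of its image along an
    ultrafilter is an attainable point, being in the closed convex hull of
    every tail.

    Three classical facts support this: the Hahn-Banach theorem
    ([ex_linear_between]); the boundedness of finite subsums of
    unconditionally convergent series ([unconditionally_cvg_bounded]); and
    the uniform boundedness of the projections [P_A], which follows from
    Zabreiko's lemma on countably subadditive seminorms ([zabreiko],
    [ex_projections]). A space with an unconditional basis is the
    unconditional sum of the lines spanned by the basis vectors, which are
    reflexive ([unconditional_sum_lines]). *)

(** * Sublinear functionals and the Hahn-Banach theorem *)

Section sublinear_functionals.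
Context {R : realType} {E : lmodType R}.
Implicit Types (p : E -> R) (C : set E).

Definition sublinear p :=
  (forall x y, p (x + y) <= p x + p y) /\
  (forall t x, 0 <= t -> p (t *: x) <= t * p x).

Lemma sublinear0 p : sublinear p -> p 0 = 0.
Proof.
move=> [pD pZ]; have := pD 0 0; have := pZ 0 0 (lexx 0).
rewrite scale0r mul0r addr0; lra.
Qed.

Lemma sublinearZ p t x : sublinear p -> 0 <= t -> p (t *: x) = t * p x.
Proof.
move=> sp t0; have [->|tn0] := eqVneq t 0.
  by rewrite scale0r mul0r sublinear0.
have tp : 0 < t by rewrite lt_neqAle eq_sym tn0.
apply/eqP; rewrite eq_le sp.2//= -ler_pdivlMl//.
rewrite -[in leLHS](scale1r x) -(mulVf tn0) -scalerA.
by apply: sp.2; rewrite invr_ge0.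
Qed.

Lemma sublinearN p x : sublinear p -> - p (- x) <= p x.
Proof. by move=> sp; have := sp.1 x (- x); rewrite subrr sublinear0//; lra. Qed.

Definition convex_set C :=
  forall x y t, C x -> C y -> 0 <= t -> t <= 1 -> C (t *: x + (1 - t) *: y).

(** The largest sublinear functional below [p] that is at most [- d] on
    [- C]; a linear functional below it is therefore at least [d] on [C]. *)
Definition tilt p C (d : R) (x : E) : R :=
  inf [set r | exists t c, [/\ 0 <= t, C c & r = p (x + t *: c) - t * d]].

Section tilt_theory.
Variables (p : E -> R) (C : set E) (d : R).
Hypotheses (sp : sublinear p) (cC : convex_set C) (C0 : C !=set0).
Hypothesis pd : forall c, C c -> d <= p c.

Lemma tilt_lb x t c : 0 <= t -> C c -> - p (- x) <= p (x + t *: c) - t * d.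
Proof.
move=> t0 Cc; have := sp.1 (x + t *: c) (- x).
rewrite [x + _]addrC addrK (sublinearZ _ sp t0).
by have := ler_wpM2l t0 (pd Cc); lra.
Qed.

Lemma tilt_le x t c : 0 <= t -> C c -> tilt p C d x <= p (x + t *: c) - t * d.
Proof.
move=> t0 Cc; apply: ge_inf; last by exists t, c.
by exists (- p (- x)) => _ [s [e [s0 Ce ->]]]; exact: tilt_lb.
Qed.

Lemma le_tilt x r :
  (forall t c, 0 <= t -> C c -> r <= p (x + t *: c) - t * d) ->
  r <= tilt p C d x.
Proof.
move=> h; apply: lb_le_inf; last by move=> _ [t [c [t0 Cc ->]]]; exact: h.
by have [c Cc] := C0; exists (p (x + 0 *: c) - 0 * d), 0, c.
Qed.

Lemma tilt_le_self x : tilt p C d x <= p x.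
Proof.
have [c Cc] := C0; have := tilt_le x (lexx 0) Cc.
by rewrite scale0r addr0 mul0r subr0.
Qed.

Lemma tiltN c : C c -> tilt p C d (- c) <= - d.
Proof.
move=> Cc; have := tilt_le (- c) ler01 Cc.
by rewrite scale1r addNr sublinear0// mul1r sub0r.
Qed.

Lemma sublinear_tilt : sublinear (tilt p C d).
Proof.
split=> [x y|t x]; last first.
  rewrite le_eqVlt => /predU1P[<-|t0].
    rewrite scale0r mul0r; apply: le_trans (tilt_le_self 0) _.
    by rewrite sublinear0.
  rewrite -ler_pdivrMl//; apply: le_tilt => s c s0 Cc.
  rewrite ler_pdivrMl//; have := tilt_le (t *: x) (mulr_ge0 (ltW t0) s0) Cc.
  by rewrite -scalerA -scalerDr (sublinearZ _ sp (ltW t0)) mulrBr mulrA.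
rewrite -lerBlDr; apply: le_tilt => t c t0 Cc.
rewrite lerBlDr [leRHS]addrC -lerBlDr; apply: le_tilt => s e s0 Ce.
rewrite lerBlDr; have [ts0|tsn0] := eqVneq (t + s) 0.
  have t00 : t = 0 by lra.
  have s00 : s = 0 by lra.
  apply: le_trans (tilt_le_self _) _.
  by rewrite t00 s00 !scale0r !mul0r !addr0 !subr0 [leRHS]addrC; exact: sp.1.
have ts : 0 < t + s by rewrite lt_neqAle eq_sym tsn0 addr_ge0.
(* t c + s e is t + s times a point of the convex set C *)
pose w := t / (t + s).
have Cw : C (w *: c + (1 - w) *: e).
  apply: cC => //; first exact: divr_ge0 t0 (ltW ts).
  by rewrite ler_pdivrMr// mul1r lerDl.
have Ew : (t + s) *: (w *: c + (1 - w) *: e) = t *: c + s *: e.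
  rewrite scalerDr !scalerA; congr (_ *: _ + _ *: _).
    by rewrite /w mulrC divfK.
  by rewrite /w; field.
apply: le_trans (tilt_le (x + y) (ltW ts) Cw) _.
rewrite Ew (addrACA x); have := sp.1 (x + t *: c) (y + s *: e).
lra.
Qed.

End tilt_theory.

(** Zorn's lemma yields a minimal sublinear functional, since the pointwise
    infimum of a chain of sublinear functionals is sublinear.  A minimal one is
    additive, hence linear: tilting it by a singleton [y] cannot decrease it. *)
Lemma ex_linear_below p : sublinear p ->
  exists g : {linear E -> R^o}, forall x, g x <= p x.
Proof.
move=> sp; pose T := {m : E -> R | sublinear m /\ forall x, m x <= p x}.
have below (m : T) x : - p (- x) <= sval m x.
  have := sublinearN x (svalP m).1; have := (svalP m).2 (- x).
  by lra.
pose le (m n : T) := `[< forall x, sval n x <= sval m x >].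
have [||||m mmin] := @Zorn T le.
- by move=> m; apply/asboolP => x.
- move=> m n k /asboolP mn /asboolP nk; apply/asboolP => x.
  exact: le_trans (nk x) (mn x).
- move=> m n /asboolP mn /asboolP nm.
  apply: eq_sig_hprop => [f|]; first exact: Prop_irrelevance.
  apply/funext => x; apply/eqP.
  by rewrite eq_le mn nm.
- move=> A Atot; have [A0|/set0P[m0 Am0]] := eqVneq A set0.
    exists (exist _ p (conj sp (fun x => lexx _))) => s.
    by rewrite A0.
  pose i x := inf [set sval m x | m in A].
  have i_le m x : A m -> i x <= sval m x.
    move=> Am; apply: ge_inf; last by exists m.
    by exists (- p (- x)) => _ [n _ <-]; exact: below.
  have le_i r x : (forall m, A m -> r <= sval m x) -> r <= i x.
    move=> h; apply: lb_le_inf; first by exists (sval m0 x), m0.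
    by move=> _ [m Am <-]; exact: h.
  have si : sublinear i.
    split=> [x y|t x]; last first.
      rewrite le_eqVlt => /predU1P[<-|t0].
        rewrite scale0r mul0r; apply: le_trans (i_le _ _ Am0) _.
        by rewrite sublinear0//; exact: (svalP m0).1.
      rewrite -ler_pdivrMl//; apply: le_i => m Am.
      rewrite ler_pdivrMl// -(sublinearZ x (svalP m).1 (ltW t0)).
      exact: i_le.
    rewrite -lerBlDr; apply: (le_i) => m Am.
    rewrite lerBlDr [leRHS]addrC -lerBlDr; apply: le_i => n An; rewrite lerBlDr.
    have [/asboolP mn|/asboolP nm] := Atot _ _ Am An.
      apply: le_trans (i_le _ _ An) _; apply: le_trans ((svalP n).1.1 _ _) _.
      by rewrite addrC lerD2l mn.
    apply: le_trans (i_le _ _ Am) _; apply: le_trans ((svalP m).1.1 _ _) _.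
    by rewrite addrC lerD2r nm.
  have ip x : i x <= p x by apply: le_trans (i_le _ _ Am0) ((svalP m0).2 x).
  exists (exist _ i (conj si ip)) => m Am; apply/asboolP => x /=.
  exact: i_le.
have sm := (svalP m).1.
have mD x y : sval m (x + y) = sval m x + sval m y.
  have C0 : [set y] !=set0 by exists y.
  have cC : convex_set [set y].
    move=> _ _ t -> -> _ _ /=; rewrite -scalerDl addrC subrK scale1r//.
  have pd c : [set y] c -> sval m y <= sval m c by move=> ->.
  have sq := sublinear_tilt sm cC C0 pd.
  have qm := tilt_le_self sm C0 pd.
  have qp z : tilt (sval m) [set y] (sval m y) z <= p z.
    by apply: le_trans (qm z) ((svalP m).2 z).
  have qE := mmin (exist _ _ (conj sq qp)) (asboolT qm).
  apply/eqP; rewrite eq_le sm.1/= -lerBrDr.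
  have := tilt_le sm pd x ler01 (erefl y); rewrite scale1r mul1r.
  by apply: le_trans; rewrite -[X in sval X x]qE.
have mN x : sval m (- x) = - sval m x.
  by have := mD x (- x); rewrite subrr (sublinear0 sm); lra.
have mL : linear (sval m : E -> R^o).
  move=> t x y; rewrite mD; congr (_ + _).
  have [t0|t0] := leP 0 t; first by rewrite sublinearZ.
  rewrite -[t in t *: x]opprK scaleNr mN sublinearZ// ?oppr_ge0 ?ltW//.
  by rewrite mulNr opprK.
pose g : {linear E -> R^o} :=
  HB.pack (sval m : E -> R^o) (GRing.isLinear.Build _ _ _ _ _ mL).
exists g.
exact: (svalP m).2.
Qed.

(** The Hahn-Banach theorem in the form of Mazur and Orlicz; with a norm for
    [p] it both separates a convex set from the origin and, applied to
    singletons, yields norming functionals. *)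
Lemma ex_linear_between p C d : sublinear p -> convex_set C -> C !=set0 ->
  (forall c, C c -> d <= p c) ->
  exists g : {linear E -> R^o},
    (forall x, g x <= p x) /\ (forall c, C c -> d <= g c).
Proof.
move=> sp cC C0 pd.
have [g gq] := ex_linear_below (sublinear_tilt sp cC C0 pd).
exists g; split=> [x|c Cc].
  exact: le_trans (gq x) (tilt_le_self sp C0 pd x).
by rewrite -lerN2 -raddfN; apply: le_trans (gq _) (tiltN sp pd Cc).
Qed.

End sublinear_functionals.

Section normed_hahn_banach.
Context {R : realType} {E : normedModType R}.

Lemma sublinear_norm : sublinear (fun x : E => `|x|).
Proof.
by split=> [x y|t x t0]; [exact: ler_normD|rewrite normrZ ger0_norm].
Qed.

Definition contractive (g : E -> R) := forall x, `|g x| <= `|x|.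

Lemma contractive_below (g : {linear E -> R^o}) :
  (forall x, g x <= `|x|) -> contractive g.
Proof.
move=> h x; rewrite ler_norml h andbT.
by have := h (- x); rewrite raddfN normrN /=; lra.
Qed.

Lemma ex_norming (x : E) : exists2 g : {linear E -> R^o},
  contractive g & g x = `|x|.
Proof.
have C0 : [set x] !=set0 by exists x.
have cC : convex_set [set x].
  by move=> _ _ t -> -> _ _ /=; rewrite -scalerDl addrC subrK scale1r.
have [c ->//|g [gn gx]] := @ex_linear_between _ _ _ _ `|x| sublinear_norm cC C0.
exists g; first exact: contractive_below.
by apply/eqP; rewrite eq_le gn gx.
Qed.

Lemma ex_separating (C : set E) (p : E) (d : R) : convex_set C ->
  C !=set0 -> (forall c, C c -> d <= `|c - p|) ->
  exists2 g : {linear E -> R^o},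
    contractive g & forall c, C c -> g p + d <= g c.
Proof.
move=> cC [c0 Cc0] dC; pose D := [set c - p | c in C].
have cD : convex_set D.
  move=> _ _ t [x Cx <-] [y Cy <-] t0 t1; exists (t *: x + (1 - t) *: y).
    exact: cC.
  rewrite !scalerBr addrACA -opprD -scalerDl [t + _]addrC subrK scale1r//.
have D0 : D !=set0 by exists (c0 - p), c0.
have [c [e Ce <-]|g [gn gD]] := ex_linear_between (d := d) sublinear_norm cD D0.
  exact: dC.
exists g; first exact: contractive_below.
move=> c Cc; have : d <= g (c - p) by apply: gD; exists c.
by rewrite raddfB /=; lra.
Qed.

End normed_hahn_banach.

(** * Slices of the unit ball of a space with the Daugavet property *)

Lemma linear_continuous_bound {R : realType} {V W : normedModType R}
    (f : {linear V -> W}) (M : R) :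
  (forall x, `|f x| <= M * `|x|) -> continuous f.
Proof.
move=> fM; apply: bounded_linear_continuous; apply/bounded_funP => r.
exists (`|M| * r) => x xr; apply: le_trans (fM x) _.
apply: le_trans (ler_wpM2l (normr_ge0 M) xr); exact/ler_wpM2r/ler_norm.
Qed.

Lemma contractive_continuous {R : realType} {V : normedModType R}
  (g : {linear V -> R^o}) : contractive g -> continuous g.
Proof.
move=> gc; apply: (linear_continuous_bound (M := 1)) => x.
by rewrite mul1r; exact: gc.
Qed.

Section slices.
Context {R : realType} {X : normedModType R}.

Definition almost_additive (e : R) (u z : X) := `|u| + 1 - e <= `|u + z|.

Definition slice (f : X -> R) (c : R) : set X :=
  [set z | `|z| <= 1 /\ c < f z].

Hypotheses (X0 : exists x : X, x != 0) (dX : Daugavet X).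

(** The Daugavet equation for the operator [z |-> f z *: x], with [x] the
    direction of [u], gives [z] in the unit ball with [z + f z *: x] of norm
    nearly [1 + N], where [N] is the norm of [f].  If [g] norms that vector,
    then [f z] is nearly [N] and both [g z] and [g x] are nearly [1].  On the
    slice of [f + g] at a level near [N + 1] both summands are nearly maximal,
    so this slice lies in the given one, and [g] bounds [`|u + z|] below. *)
Lemma subslice_almost_additive1 (f : {linear X -> R^o}) (c e : R) (u : X) :
  continuous f -> f != 0 :> (X -> R^o) -> 0 < e -> slice f c !=set0 ->
  exists (h : {linear X -> R^o}) (c' : R), [/\ continuous h,
    slice h c' !=set0, slice h c' `<=` slice f c &
    slice h c' `<=` [set z | almost_additive e u z]].
Proof.
move=> cf f0 e0 [z0 [z01 cfz0]]; pose N := opnorm f.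
have fN z : `|z| <= 1 -> `|f z| <= N by move=> z1; exact: opnorm_ub.
have [y fy0] : exists y, f y != 0.
  apply: contrapT => h; move/eqP: f0; apply; apply/funext => y.
  by apply: contrapT => fy; apply: h; exists y; apply/eqP.
have N0 : 0 < N.
  rewrite ltNge; apply/negP => N0; have := ler_opnorm y cf.
  move: fy0; rewrite -normr_gt0 => fy0; apply/negP; rewrite -ltNge.
  by apply: le_lt_trans fy0; rewrite mulr_le0_ge0.
have cN : c < N by apply: lt_le_trans cfz0 (le_trans (ler_norm _) (fN _ z01)).
have [x [x1 ux]] : exists x, `|x| = 1 /\ u = `|u| *: x.
  have [->|u0] := eqVneq u 0.
    have [x x0] := X0; exists (`|x|^-1 *: x).
    rewrite normr0 scale0r; split=> //.
    by rewrite normrZ normfV normr_id mulVf// normr_eq0.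
  exists (`|u|^-1 *: u); split.
    by rewrite normrZ normfV normr_id mulVf// normr_eq0.
  by rewrite scalerA divff ?scale1r// normr_eq0.
(* the loss in the final estimate is k times the defect d *)
pose k := 2 + `|u| / N.
have k0 : 0 < k by rewrite ltr_wpDr// divr_ge0// ltW.
pose d := Num.min ((N - c) / 2) (Num.min N (e / k)).
have d0 : 0 < d by rewrite !lt_min divr_gt0 ?subr_gt0// N0 divr_gt0.
have [dNc dN dk] : [/\ d <= (N - c) / 2, d <= N & d <= e / k].
  by rewrite /d !ge_min !lexx !orbT.
have lT : linear (fun z => f z *: x).
  by move=> a v w; rewrite linearP scalerDl scalerA.
pose T : {linear X -> X} :=
  HB.pack (fun z => f z *: x) (GRing.isLinear.Build _ _ _ _ _ lT).
have cT : continuous T.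
  apply: (linear_continuous_bound (M := N)) => z.
  by rewrite /= normrZ x1 mulr1; exact: ler_opnorm.
have rT : rank_one T.
  exists x; first by rewrite -normr_gt0 x1.
  apply/seteqP; split=> [_ [z _ <-]|_ [a _ <-]]; first by exists (f z).
  exists ((a / f y) *: y) => //=; rewrite linearZ /=.
  by congr (_ *: _); exact: divfK.
have TN : N <= opnorm T.
  apply: opnorm_le => z z1; have := opnorm_ub cT z1.
  by rewrite /= normrZ x1 mulr1.
have [z [z1 fz0 zN]] : exists z, [/\ `|z| <= 1, 0 <= f z &
    1 + N - d < `|z + f z *: x|].
  suff [z [z1 zN]] : exists z, `|z| <= 1 /\ 1 + N - d < `|z + f z *: x|.
    have [fz|fz] := leP 0 (f z); first by exists z.
    exists (- z); rewrite normrN raddfN oppr_ge0; split=> //; first exact: ltW.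
    by rewrite scaleNr -opprD normrN.
  apply: contrapT => h; have := dX cT rT; apply/eqP.
  rewrite lt_eqF//; apply: (@le_lt_trans _ _ (1 + N - d)); last lra.
  apply: ge_sup; first by exists `|0 + T 0|, 0 => //=; rewrite normr0.
  move=> _ [z /= z1 <-]; rewrite leNgt; apply/negP => zd.
  by apply: h; exists z.
have [g gc gz] := ex_norming (z + f z *: x).
have gZ a v w : g (v + a *: w) = g v + a * g w.
  by rewrite raddfD; congr (_ + _); exact: linearZ.
rewrite -{}gz gZ in zN.
have g1 w : `|w| <= 1 -> g w <= 1.
  by move=> w1; apply: le_trans (ler_norm _) (le_trans (gc _) w1).
have f1 w : `|w| <= 1 -> f w <= N.
  by move=> w1; apply: le_trans (ler_norm _) (fN _ w1).
have gz1 := g1 _ z1; have fz1 := f1 _ z1.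
have gx1 : g x <= 1 by apply: g1; rewrite x1.
have fgx : f z * g x <= f z by rewrite ler_piMr.
have gx0 : 0 <= g x.
  rewrite leNgt; apply/negP => gx0.
  by have : f z * g x <= 0 by [rewrite mulr_ge0_le0// ltW]; lra.
have fgN : f z * g x <= N * g x by exact: ler_wpM2r.
exists (f \+ g), (1 + N - d *+ 2); split.
- move=> w; apply: cvgD; first exact: cf.
  exact: contractive_continuous.
- by exists z; split=> //=; rewrite mulr2n; lra.
- move=> w [w1 /=]; have := g1 _ w1; rewrite mulr2n => ? ?; split=> //; lra.
move=> w [w1 /=]; have := f1 _ w1; rewrite mulr2n => fw hw.
rewrite /almost_additive; apply: le_trans (le_trans (ler_norm _) (gc (u + w))).
rewrite [u + w]addrC {2}ux gZ.
have uN : 0 <= `|u| / N by rewrite divr_ge0// ltW.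
have : `|u| / N * (N - d) <= `|u| / N * (N * g x).
  by apply: ler_wpM2l => //; lra.
rewrite mulrBr mulrA divfK ?gt_eqF//.
move: dk; rewrite ler_pdivlMr// /k mulrDr [d * (_ / _)]mulrC.
lra.
Qed.


(** The zero functional cuts out the whole ball, so any nonzero functional may
    take its place. *)
Lemma subslice_almost_additive (f : {linear X -> R^o}) (c e : R) (u : X) :
  continuous f -> 0 < e -> slice f c !=set0 ->
  exists (h : {linear X -> R^o}) (c' : R), [/\ continuous h,
    slice h c' !=set0, slice h c' `<=` slice f c &
    slice h c' `<=` [set z | almost_additive e u z]].
Proof.
move=> cf e0 fc0; have [f0|] := eqVneq (f : X -> R^o) 0; last first.
  by move=> f0; exact: subslice_almost_additive1.
have [x x0] := X0; have [g gc gx] := ex_norming x.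
have g0 : g != 0 :> (X -> R^o).
  apply/eqP => /(congr1 (@^~ x)); rewrite /= gx => /eqP.
  by rewrite normr_eq0; exact/negP.
have gc0 : slice g 0 !=set0.
  exists (`|x|^-1 *: x); split=> /=.
    by rewrite normrZ normfV normr_id mulVf// normr_eq0.
  have -> : g (`|x|^-1 *: x) = `|x|^-1 * g x by exact: linearZ.
  by rewrite gx mulVf// normr_eq0.
have [h [c' [ch h0 hg hu]]] :=
  subslice_almost_additive1 u (contractive_continuous gc) g0 e0 gc0.
exists h, c'; split=> // z /hg[z1 _]; split=> //.
by move: fc0 => [y [_]]; rewrite /= f0.
Qed.

(** All points of the slice found for one vector are good for it, so a slice
    can be shrunk for several vectors in turn. *)
Lemma slice_almost_additive_seq (l : seq X) (f : {linear X -> R^o}) (c e : R) :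
  continuous f -> 0 < e -> slice f c !=set0 ->
  exists2 z, slice f c z & forall u, u \in l -> almost_additive e u z.
Proof.
move=> + e0; elim: l f c => [|u l IH] f c cf fc.
  by have [z fz] := fc; exists z.
have [h [c' [ch h0 hf hu]]] := subslice_almost_additive u cf e0 fc.
have [z hz zl] := IH _ _ ch h0; exists z; first exact: hf.
by move=> v; rewrite in_cons => /predU1P[->|]; [exact: hu|exact: zl].
Qed.

Lemma slice_almost_additive_compact (K : set X) (f : {linear X -> R^o})
    (c e : R) : compact K -> continuous f -> 0 < e -> slice f c !=set0 ->
  exists2 z, slice f c z & forall u, K u -> almost_additive e u z.
Proof.
move=> cK cf e0 fc; have e30 : 0 < e / 3 by rewrite divr_gt0.
move: cK; rewrite compact_cover => /(_ _ K (fun x => ball x (e / 3))).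
case=> [x _|x Kx|D DK KD]; first exact: ball_open.
  by exists x => //; exact: ballxx.
have [z fz zD] := slice_almost_additive_seq (finmap.enum_fset D) cf e30 fc.
exists z => // u /KD[v /= vD]; have := zD v vD; rewrite /almost_additive.
rewrite -ball_normE /= => vz vu.
have uE : `|u| <= `|v| + `|v - u|.
  by rewrite -[in leLHS](subKr v u) ler_normB.
have vE : `|v + z| <= `|u + z| + `|v - u|.
  by apply: le_trans (ler_normD _ _); rewrite [in leRHS]addrC addrA subrK.
lra.
Qed.

End slices.

(** * Sequences with almost additive convex combinations *)

Section almost_additive_sequences.
Context {R : realType} {X : normedModType R}.

Lemma ex_dense_seq : separable_space X ->
  exists x : nat -> X, forall u e, 0 < e -> exists i, `|u - x i| < e.
Proof.
move=> [A cA dA].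
have dense_ball u e : 0 < e -> exists2 a, A a & `|u - a| < e.
  move=> e0; have [||a [uea Aa]] := dA (ball u e).
  - by exists u; exact: ballxx.
  - exact: ball_open.
  - by exists a => //; move: uea; rewrite -ball_normE.
move/pfcard_geP : cA => [A0|[s]].
  by have [a] := dense_ball 0 1 ltr01; rewrite A0.
exists s => u e /(dense_ball u)[a Aa ua].
by have [i _ ia] := @surj _ _ setT A s a Aa; exists i; rewrite ia.
Qed.

Lemma almost_additive_scale (e t : R) (u z : X) :
  `|z| <= 1 -> t <= 1 -> almost_additive e u z ->
  `|u| + t - e <= `|u + t *: z|.
Proof.
rewrite /almost_additive => z1 t1 uz.
have : `|u + z| <= `|u + t *: z| + `|(1 - t) *: z|.
  apply: le_trans (ler_normD _ _).
  by rewrite -addrA -scalerDl [t + _]addrC subrK scale1r.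
have : `|(1 - t) *: z| <= 1 - t.
  by rewrite normrZ ger0_norm ?subr_ge0// ler_piMr// subr_ge0.
lra.
Qed.

Lemma compact_shift_segment (K : set X) (z : X) : compact K ->
  compact [set u.1 + u.2 *: z | u in K `*` `[0, 1%R : R]].
Proof.
move=> cK; apply: continuous_compact.
  apply: continuous_subspaceT => -[u t] /=.
  apply: cvgD; first exact: cvg_fst.
  by apply: cvgZl; exact: cvg_snd.
by apply: compact_setX => //; exact: segment_compact.
Qed.

Hypotheses (X0 : exists x : X, x != 0) (dX : Daugavet X).

(** The term [z i] is chosen almost additive over a compact set [K i], and
    [K i.+1] absorbs the translates of [K i] by the multiples [t *: z i] with
    [0 <= t <= 1].  So a convex combination of terms from [n] on can be added to
    a vector of [K n] one summand at a time, with summable errors.  The sets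
    [K i] also absorb a dense sequence, which is how separability lets
    countably many compact sets serve every vector [u]. *)
Lemma ex_almost_additive_seq (f : {linear X -> R^o}) (c : R) :
  separable_space X -> continuous f -> slice f c !=set0 ->
  exists z : nat -> X, (forall i, slice f c (z i)) /\
    forall u e, 0 < e -> exists n, forall (w : nat -> R) N, (n <= N)%N ->
      (forall i, 0 <= w i <= 1) -> \sum_(n <= i < N) w i = 1 ->
      almost_additive e u (\sum_(n <= i < N) w i *: z i).
Proof.
move=> /ex_dense_seq[x xdense] cf fc.
have pick (Ki : set X * nat) : exists z, compact Ki.1 ->
    slice f c z /\ forall u, Ki.1 u -> almost_additive (2^-1 ^+ Ki.2.+1) u z.
  have [cK|] := pselect (compact Ki.1); last by exists 0.
  have e0 : 0 < 2^-1 ^+ Ki.2.+1 :> R by rewrite exprn_gt0// invr_gt0.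
  have [z zf zK] := slice_almost_additive_compact X0 dX cK cf e0 fc.
  by exists z.
have [zsel zselP] := choice pick.
pose K := fix K n := if n is i.+1 then
  [set u.1 + u.2 *: zsel (K i, i) | u in K i `*` `[0, 1%R : R]] `|` [set x i]
  else set0.
pose z i := zsel (K i, i).
have cK i : compact (K i).
  elim: i => [|i IH] /=; first exact: compact0.
  by apply: compactU; [exact: compact_shift_segment|exact: compact_set1].
have KS i u t : K i u -> 0 <= t <= 1 -> K i.+1 (u + t *: z i).
  by move=> Ku t01; left; exists (u, t) => //=; split=> //=; rewrite in_itv.
have Kmono i j u : (i <= j)%N -> K i u -> K j u.
  elim: j => [|j IH]; first by rewrite leqn0 => /eqP ->.
  rewrite leq_eqVlt ltnS => /predU1P[<-//|/IH{}IH /IH Kj].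
  by rewrite -[u]addr0 -(scale0r (z j)); apply: KS => //; rewrite lexx ler01.
have zf i : slice f c (z i) by have [] := zselP (K i, i) (cK i).
have zK i u : K i u -> almost_additive (2^-1 ^+ i.+1) u (z i).
  by have [_] := zselP (K i, i) (cK i); exact.
have Ksum n u (w : nat -> R) N : (n <= N)%N -> (forall i, 0 <= w i <= 1) ->
    K n u -> K N (u + \sum_(n <= i < N) w i *: z i) /\
    `|u| + \sum_(n <= i < N) w i - (2^-1 ^+ n - 2^-1 ^+ N) <=
    `|u + \sum_(n <= i < N) w i *: z i|.
  move=> + w01 Kn; elim: N => [|N IH].
    rewrite leqn0 => /eqP n0; move: Kn; rewrite n0 => Kn.
    by rewrite !big_nil !addr0 subrr subr0.
  rewrite leq_eqVlt ltnS => /predU1P[<-|nN].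
    by rewrite !big_geq// !addr0 subrr subr0.
  have [KN le] := IH nN; rewrite !big_nat_recr//= !addrA; split.
    exact: KS.
  have [_ w1] := andP (w01 N).
  have := almost_additive_scale (zf N).1 w1 (zK _ _ KN).
  rewrite !exprS; move: le; set a := 2^-1 ^+ N; lra.
exists z; split=> // u e e0; have e40 : 0 < e / 4 by rewrite divr_gt0.
have [m um] := xdense u _ e40.
have [k ke] : exists k, 2^-1 ^+ k < e / 4.
  have := @cvg_geometric R 1 2^-1.
  rewrite ger0_norm ?invr_ge0// invf_lt1// ltr1n => /(_ isT).
  move=> /cvgr0_norm_lt /(_ _ e40)[k _ /(_ k (leqnn k))] /=.
  rewrite mul1r ger0_norm ?exprn_ge0 ?invr_ge0// => ?.
  by exists k.
pose n := maxn m.+1 k; exists n => w N nN w01 w1.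
have Kx : K n (x m).
  by apply: (@Kmono m.+1); [exact: leq_maxl|right].
have [_] := Ksum _ _ _ _ nN w01 Kx; rewrite w1 /almost_additive.
set s := \sum_(_ <= _ < _) _.
have : `|u| <= `|u - x m| + `|x m|.
  by rewrite -[in leLHS](subrK (x m) u) ler_normD.
have : `|x m + s| <= `|u - x m| + `|u + s|.
  rewrite (distrC u); apply: le_trans (ler_normD _ _).
  by rewrite addrA subrK.
have : 2^-1 ^+ n <= 2^-1 ^+ k :> R.
  by apply: ler_wiXn2l; rewrite ?invr_ge0// ?invf_le1// ?ler1n// leq_maxr.
have : 0 <= 2^-1 ^+ N :> R by rewrite exprn_ge0// invr_ge0.
lra.
Qed.

End almost_additive_sequences.

(** * Weakly compact operators are narrow *)

Section narrow_operators.
Context {R : realType} {X Y : normedModType R}.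

(** Weak compactness of the closure of the image of the unit ball, expressed by
    weak limits along ultrafilters instead of the weak topology of [Y]. *)
Definition weakly_compact (T : X -> Y) :=
  forall (U : set_system nat) (z : nat -> X), UltraFilter U ->
    (forall k, `|z k| <= 1) ->
    exists p, forall g : {linear Y -> R^o}, contractive g ->
      g (T (z k)) @[k --> U] --> g p.

Definition attainable (T : X -> Y) (p : Y) := forall u e, 0 < e ->
  exists z, [/\ `|z| <= 1, almost_additive e u z & `|T z - p| < e].

(** The preimage [v] for [q] is chosen after the preimage [z] for [p], almost
    additive at [u + t *: z] instead of [u]. *)
Lemma convex_attainable (T : {linear X -> Y}) : convex_set (attainable T).
Proof.
move=> p q t pT qT t0 t1 u e e0; have e20 : 0 < e / 2 by rewrite divr_gt0.
have [z [z1 uz zp]] := pT u _ e20.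
have [v [v1 uv vq]] := qT (u + t *: z) _ e20.
have s0 : 0 <= 1 - t by rewrite subr_ge0.
have s1 : 1 - t <= 1 by rewrite lerBlDr lerDl.
have combo (V : normedModType R) (a b : V) (c : R) : `|a| <= c -> `|b| <= c ->
    `|t *: a + (1 - t) *: b| <= c.
  move=> ac bc; apply: le_trans (ler_normD _ _) _.
  rewrite !normrZ !ger0_norm//; have := ler_wpM2l t0 ac.
  by have := ler_wpM2l s0 bc; lra.
exists (t *: z + (1 - t) *: v); split; first exact: combo.
  have := almost_additive_scale v1 s1 uv; rewrite -[u + _ + _]addrA.
  by have := almost_additive_scale z1 t1 uz; rewrite /almost_additive; lra.
rewrite linearD !linearZ /= opprD addrACA -!scalerBr.
by apply: le_lt_trans (combo _ _ _ _ (ltW zp) (ltW vq)) _; lra.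
Qed.

Lemma attainable_closed (T : X -> Y) (p : Y) :
  (forall d, 0 < d -> exists2 q, attainable T q & `|q - p| < d) ->
  attainable T p.
Proof.
move=> h u e e0; have e20 : 0 < e / 2 by rewrite divr_gt0.
have [q qT qp] := h _ e20; have [z [z1 uz zq]] := qT u _ e20.
exists z; split=> //; first by move: uz; rewrite /almost_additive; lra.
have -> : T z - p = (T z - q) + (q - p) by rewrite addrA subrK.
apply: le_lt_trans (ler_normD _ _) _; lra.
Qed.

Hypotheses (X0 : exists x : X, x != 0) (dX : Daugavet X).
Hypothesis sX : separable_space X.

(** The weak limit [p] of the images of an almost additive sequence in the slice
    lies in the closed convex hull of every tail of those images, by separation;
    and convex combinations of late terms are almost additive. *)
Lemma ex_attainable_slice (T : {linear X -> Y}) (f : {linear X -> R^o}) c :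
  weakly_compact T -> continuous f -> slice f c !=set0 ->
  exists2 p, attainable T p & forall (g : {linear Y -> R^o}) b,
    contractive g -> (forall z, slice f c z -> g (T z) <= b) -> g p <= b.
Proof.
move=> wT cf fc; have [z [zf zsum]] := ex_almost_additive_seq X0 dX sX cf fc.
have [U [UU ooU]] := @ultraFilterLemma nat \oo _.
have [p pz] := wT U z UU (fun k => (zf k).1).
exists p => [u e e0|g b gc gb]; last first.
  rewrite leNgt; apply/negP => bp.
  have near_p : U [set k | b < g (T (z k))] by apply: cvgr_gt (pz g gc) _ bp.
  by have [k /=] := filter_ex near_p; rewrite ltNge gb.
have [n nP] := zsum u e e0; apply: contrapT => noz.
pose C := [set y | exists w N, [/\ (n <= N)%N, (forall i, 0 <= w i <= 1),
  (forall i, (N <= i)%N -> w i = 0), \sum_(n <= i < N) w i = 1 &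
  y = T (\sum_(n <= i < N) w i *: z i)]].
have Cz k : (n <= k)%N -> C (T (z k)).
  move=> nk; exists (fun i => (i == k)%:R), k.+1; split.
  - exact: leqW.
  - by move=> i; case: (i == k); rewrite lexx ler01.
  - by move=> i ki; rewrite gtn_eqF.
  - rewrite big_nat_recr//= eqxx big_nat_cond big1 ?add0r// => i.
    by rewrite andbT => /andP[_ ik]; rewrite ltn_eqF.
  - rewrite big_nat_recr//= eqxx scale1r big_nat_cond big1 ?add0r// => i.
    by rewrite andbT => /andP[_ ik]; rewrite ltn_eqF// scale0r.
have Cext (w : nat -> R) N M : (n <= N)%N -> (N <= M)%N ->
    (forall i, (N <= i)%N -> w i = 0) ->
    \sum_(n <= i < M) w i = \sum_(n <= i < N) w i /\
    \sum_(n <= i < M) w i *: z i = \sum_(n <= i < N) w i *: z i.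
  move=> nN NM w0; rewrite !(big_cat_nat nN NM) /=.
  have w0' i : (N <= i < M)%N -> w i = 0 by case/andP => + _; exact: w0.
  by split; rewrite [X in _ + X]big_nat_cond [X in _ + X]big1 ?addr0// => i;
    rewrite andbT => /w0' ->; rewrite ?scale0r.
have cC : convex_set C.
  move=> _ _ t [v [N [nN v01 v0 v1 ->]]] [w [M [nM w01 w0 w1 ->]]] t0 t1.
  pose L := maxn N M; have NL : (N <= L)%N := leq_maxl _ _.
  have ML : (M <= L)%N := leq_maxr _ _.
  have [v1' <-] := Cext _ _ _ nN NL v0; have [w1' <-] := Cext _ _ _ nM ML w0.
  exists (fun i => t * v i + (1 - t) * w i), L; split.
  - exact: leq_trans NL.
  - move=> i; have /andP[? ?] := v01 i; have /andP[? ?] := w01 i.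
    have t1' : 0 <= 1 - t by rewrite subr_ge0.
    have := ler_wpM2l t0 (proj2 (andP (v01 i))).
    have := ler_wpM2l t1' (proj2 (andP (w01 i))).
    by rewrite addr_ge0 ?mulr_ge0//=; lra.
  - move=> i Li; rewrite v0 ?w0 ?mulr0 ?addr0//; exact: leq_trans Li.
  - rewrite big_split/= -!mulr_sumr v1' w1' v1 w1; lra.
  - rewrite -!linearZ -linearD /= !scaler_sumr -big_split /=.
    by congr (T _); apply: eq_bigr => i _; rewrite scalerDl !scalerA.
have dC c' : C c' -> e <= `|c' - p|.
  move=> [w [N [nN w01 w0 w1 ->]]]; rewrite leNgt; apply/negP => ep.
  apply: noz; exists (\sum_(n <= i < N) w i *: z i); split=> //.
    apply: le_trans (ler_norm_sum _ _ _) _; rewrite -w1; apply: ler_sum => i _.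
    have /andP[wi0 _] := w01 i.
    by rewrite normrZ ger0_norm// ler_piMr//; exact: (zf i).1.
  exact: nP.
have C0 : C !=set0 by exists (T (z n)); exact: Cz.
have [g gc gC] := ex_separating cC C0 dC.
have near_p : U [set k | g (T (z k)) < g p + e].
  by apply: cvgr_lt (pz g gc) _ _; rewrite ltrDl.
have near_n : U [set k | (n <= k)%N] by apply: ooU; exact: nbhs_infty_ge.
have [k [/= + nk]] := filter_ex (filterI near_p near_n).
by rewrite ltNge gC//; exact: Cz.
Qed.

(** The attainable points form a closed convex set that meets every slice of
    [T (ball)], so by separation it contains [T (ball)]. *)
Lemma weakly_compact_narrow (T : {linear X -> Y}) y :
  continuous T -> weakly_compact T -> `|y| <= 1 -> attainable T (T y).
Proof.
move=> cT wT y1; apply: attainable_closed => d d0; apply: contrapT => noq.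
have dC q : attainable T q -> d <= `|q - T y|.
  by move=> qT; rewrite leNgt; apply/negP => qy; apply: noq; exists q.
have C0 : attainable T !=set0.
  have [x x0] := X0; have [f fc _] := ex_norming x.
  have fy : slice f (f y - 1) !=set0.
    by exists y; split=> //; rewrite ltrBlDr ltrDl.
  have [p pT _] := ex_attainable_slice wT (contractive_continuous fc) fy.
  by exists p.
have [g gc gC] := ex_separating (convex_attainable (T := T)) C0 dC.
pose f : {linear X -> R^o} := \- (g \o T).
have cf : continuous f.
  move=> x; apply: cvgN; apply: continuous_comp; first exact: cT.
  exact: contractive_continuous.
have fy : slice f (- (g (T y) + d / 2)) !=set0.
  by exists y; split=> //=; rewrite ltrN2 ltrDl divr_gt0.
have [p pT pg] := ex_attainable_slice wT cf fy.
have := gC _ pT; apply/negP; rewrite -ltNge.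
have gp : g p <= g (T y) + d / 2.
  by apply: pg => // z [_ /=]; rewrite ltrN2 => /ltW.
by lra.
Qed.

End narrow_operators.

(** * Finite subsums of unconditionally convergent series *)

Section rearrangements.

(** The permutation lists, within each block of indices from [b k] to
    [b k.+1], first the members of [A k] and then the others. *)
Lemma ex_block_permutation (b : nat -> nat) (A : nat -> pred nat) :
  b 0 = 0%N -> (forall k, (b k < b k.+1)%N) ->
  exists2 s : nat -> nat, bijective s & forall k, exists2 c, (b k <= c)%N &
    forall (V : zmodType) (x : nat -> V),
      \sum_(b k <= i < c) x (s i) = \sum_(b k <= i < b k.+1 | A k i) x i.
Proof.
move=> b0 bS.
have bmono k l : (k <= l)%N -> (b k <= b l)%N.
  by move=> kl; apply: (homo_leq (f := b) (r := leq)) kl => //;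
    [exact: leq_trans|move=> i; exact: ltnW].
have bge k : (k <= b k)%N.
  by elim: k => // k IH; exact: leq_ltn_trans (bS k).
have ex n : exists k, (n < b k.+1)%N by exists n; exact: leq_ltn_trans (bS n).
pose blk n := ex_minn (ex n).
have blkP n : (b (blk n) <= n < b (blk n).+1)%N.
  rewrite /blk; case: ex_minnP => k nk kmin; rewrite nk andbT.
  case: k nk kmin => [|k] nk kmin; first by rewrite b0.
  by rewrite leqNgt; apply/negP => /kmin; rewrite ltnn.
have blk_unique n k : (b k <= n < b k.+1)%N -> blk n = k.
  move=> /andP[kn nk]; have /andP[bn nb] := blkP n.
  apply/eqP; rewrite eqn_leq -[(blk n <= k)%N]ltnS -[(k <= blk n)%N]ltnS.
  by apply/andP; split; rewrite ltnNge; apply/negP => /bmono h;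
    [have := leq_trans nk h|have := leq_trans nb h];
    rewrite ltnNge ?bn ?kn.
pose r k := index_iota (b k) (b k.+1).
pose L k := [seq i <- r k | A k i] ++ [seq i <- r k | predC (A k) i].
have permL k : perm_eq (L k) (r k) by rewrite perm_filterC.
have memL k i : (i \in L k) = (b k <= i < b k.+1)%N.
  by rewrite (perm_mem (permL k)) mem_index_iota.
have uniqL k : uniq (L k) by rewrite (perm_uniq (permL k)) iota_uniq.
have sizeL k : size (L k) = (b k.+1 - b k)%N.
  by rewrite (perm_size (permL k)) size_iota.
have lt_off n : (n - b (blk n) < size (L (blk n)))%N.
  have /andP[bn nb] := blkP n.
  by rewrite sizeL ltn_sub2r// (leq_ltn_trans bn nb).
pose s n := nth 0%N (L (blk n)) (n - b (blk n)).
pose s' j := (b (blk j) + index j (L (blk j)))%N.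
have blk_s n : blk (s n) = blk n.
  by apply: blk_unique; rewrite -memL mem_nth.
have mem_blk j : j \in L (blk j) by rewrite memL blkP.
have blk_s' j : blk (s' j) = blk j.
  apply: blk_unique; rewrite leq_addr/= /s'.
  move: (mem_blk j); rewrite -index_mem sizeL; have /ltnW := bS (blk j).
  by move=> ble ?; rewrite -ltn_subRL.
exists s.
  exists s' => n; rewrite /s' /s.
    rewrite -/(s n) blk_s index_uniq// subnKC//.
    by have /andP[] := blkP n.
  by rewrite -/(s' n) blk_s' addKn nth_index.
move=> k; exists (b k + size [seq i <- r k | A k i])%N; first exact: leq_addr.
move=> V x; rewrite -[RHS]big_filter -/(r k) (big_nth 0%N).
rewrite -{1}[b k]add0n big_addn addKn big_nat [RHS]big_nat.
apply: eq_bigr => i /andP[_ isz]; congr x.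
have iL : (i < size (L k))%N by rewrite size_cat (leq_trans isz)// leq_addr.
have -> : s (i + b k)%N = nth 0%N (L k) i.
  rewrite /s (blk_unique _ k) ?addnK// leq_addl/=.
  by move: iL; rewrite sizeL ltn_subRL addnC.
by rewrite nth_cat isz.
Qed.

(** If subsums far out did not become small, disjoint blocks with large subsums
    could be picked, and rearranging each block so that these subsums become
    consecutive would destroy the Cauchy property. *)
Lemma unconditionally_cvg_bounded {R : realType} {Y : completeNormedModType R}
    (x : nat -> Y) : unconditionally_cvg x ->
  exists M, forall (A : pred nat) N, `|\sum_(0 <= i < N | A i) x i| <= M.
Proof.
move=> ux.
have [m mP] : exists m, forall (A : pred nat) N, 
    `|\sum_(m <= i < N | A i) x i| <= 1.
  apply: contrapT => h.
  have {}h m : exists AN : pred nat * nat, 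
      1 < `|\sum_(m <= i < AN.2 | AN.1 i) x i|.
    apply: contrapT => h'; apply: h; exists m => A N; rewrite leNgt.
    by apply/negP => ?; apply: h'; exists (A, N).
  have [AN ANP] := choice h.
  pose b := fix b k := if k is l.+1 then (AN (b l)).2 else 0%N.
  have bS k : (b k < b k.+1)%N.
    rewrite ltnNge; apply/negP => bk; have := ANP (b k).
    by rewrite big_geq// normr0 ltr10.
  have bge k : (k <= b k)%N.
    by elim: k => // k IH; exact: leq_ltn_trans (bS k).
  have [s sbij sP] := ex_block_permutation (fun k => (AN (b k)).1) erefl bS.
  have /cvg_cauchy/cauchy_seriesP/(_ _ ltr01) := ux s sbij.
  case=> -[P Q] /= [[p _ pP] [q _ qQ]] PQ.
  pose k := maxn p q; have [c kc sumE] := sP k.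
  have pk : (p <= b k)%N := leq_trans (leq_maxl p q) (bge k).
  have qc : (q <= c)%N.
    exact: leq_trans (leq_trans (leq_maxr p q) (bge k)) kc.
  have := PQ (b k, c) (conj (pP _ pk) (qQ _ qc)).
  by rewrite /= sumE ltNge ltW.
exists (\sum_(0 <= i < m) `|x i| + 1) => A N.
have [mN|Nm] := leqP m N.
  rewrite (big_cat_nat (leq0n m) mN) /=; apply: le_trans (ler_normD _ _) _.
  apply: lerD => //; apply: le_trans (ler_norm_sum _ _ _) _.
  by rewrite big_mkcond; apply: ler_sum => i _; case: ifP.
apply: le_trans (ler_norm_sum _ _ _) _.
rewrite (big_cat_nat (leq0n N) (ltnW Nm)) /= -addrA.
rewrite big_mkcond /=; apply: ler_wpDr; last first.
  by apply: ler_sum => i _; case: ifP.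
by rewrite addr_ge0// sumr_ge0.
Qed.

End rearrangements.

(** * Countably subadditive seminorms on Banach spaces *)

Section countably_subadditive_seminorms.
Context {R : realType} {Y : completeNormedModType R}.

(** Zabreiko's lemma.  By Baire some set [N <= n] is dense in a ball, hence
    every [y] is approximated to any accuracy by [v] with [N v <= c * `|y|];
    iterating on the remainders writes [y] as a series to which countable
    subadditivity applies. *)
Lemma zabreiko (N : Y -> R) :
  (forall y z, N (y + z) <= N y + N z) ->
  (forall t y, N (t *: y) = `|t| * N y) ->
  (forall (v : nat -> Y) y M, series v @ \oo --> y ->
    (forall m, \sum_(0 <= k < m) N (v k) <= M) -> N y <= M) ->
  exists2 C, 0 <= C & forall y, N y <= C * `|y|.
Proof.
move=> ND NZ Nsub.
have N0 : N 0 = 0 by rewrite -(scale0r (0 : Y)) NZ normr0 mul0r.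
have NN y : N (- y) = N y by rewrite -scaleN1r NZ normrN normr1 mul1r.
have Nge0 y : 0 <= N y by have := ND y (- y); rewrite subrr N0 NN; lra.
pose F n := closure [set y | N y <= n%:R].
have [n [y0 [r r0 y0F]]] : exists n y0, exists2 r, 0 < r & ball y0 r `<=` F n.
  apply: contrapT => h.
  have dF n : open (~` F n) /\ dense (~` F n).
    split; first by apply: closed_openC; exact: closed_closure.
    move=> O [y Oy] oO; apply: contrapT => OF; apply: h.
    have /nbhs_ballP[r /= r0 yr] := open_nbhs_nbhs (conj oO Oy).
    exists n, y, r => // z /yr Oz; apply: contrapT => Fz; apply: OF.
    by exists z.
  have [|y [_ yF]] := Baire dF (_ : setT !=set0) openT.
    by exists 0.
  have [n yn] : exists n : nat, N y <= n%:R.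
    by exists (Num.bound (N y)); apply: ltW; rewrite archi_boundP.
  by apply: (yF n I); exact: subset_closure.
have appr y e : 0 < e -> exists2 z, N z <= (4 * n%:R / r) * `|y| & `|y - z| < e.
  move=> e0; have [->|yn0] := eqVneq y 0.
    by exists 0; rewrite ?N0 ?normr0 ?mulr0// subrr normr0.
  have ny : 0 < `|y| by rewrite normr_gt0.
  (* t *: y has norm r / 2, so y0 + t *: y and y0 - t *: y lie in the ball;
     y is recovered from half the difference of their approximations *)
  pose t := r / (2 * `|y|); have t0 : 0 < t by rewrite divr_gt0// mulr_gt0.
  have tE : t * `|y| = r / 2 by rewrite /t; field; lra.
  have te0 : 0 < t * e by rewrite mulr_gt0.
  have clo z : `|z| < r -> exists2 a, N a <= n%:R & `|y0 + z - a| < t * e.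
    move=> zr; have /(_ (ball (y0 + z) (t * e))) : F n (y0 + z).
      by apply: y0F; rewrite -ball_normE /= opprD addNKr normrN.
    case; first exact: nbhsx_ballx.
    by move=> a [Na]; rewrite -ball_normE => ?; exists a.
  have tyr : `|t *: y| < r by rewrite normrZ gtr0_norm// tE; lra.
  have [a Na ya] := clo _ tyr.
  have [|b Nb yb] := clo (- (t *: y)); first by rewrite normrN.
  have t20 : 0 < 2 * t by rewrite mulr_gt0.
  have t2N : `|(2 * t)^-1| = (2 * t)^-1 by rewrite gtr0_norm// invr_gt0.
  exists ((2 * t)^-1 *: (a - b)).
    rewrite NZ t2N ler_pdivrMl//.
    have -> : 2 * t * (4 * n%:R / r * `|y|) = 8 * n%:R / r * (t * `|y|).
      by field; lra.
    have -> : 8 * n%:R / r * (t * `|y|) = 4 * n%:R by rewrite tE; field; lra.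
    have := ND a (- b); rewrite NN.
    by have : 0 <= n%:R :> R by []; lra.
  have -> : y - (2 * t)^-1 *: (a - b) = (2 * t)^-1 *:
      ((y0 + t *: y - a) - (y0 - t *: y - b)).
    apply: (@scalerI _ _ (2 * t)); first by rewrite gt_eqF.
    rewrite scalerBr !scalerA divff ?gt_eqF// !scale1r.
    rewrite mulr_natl mulr2n scalerDl.
    rewrite !opprD !opprK [RHS]addrACA; congr (_ + _).
    by rewrite addrACA subrr add0r.
  rewrite normrZ t2N ltr_pdivrMl//; apply: le_lt_trans (ler_normB _ _) _.
  lra.
set c := 4 * n%:R / r in appr.
have c0 : 0 <= c by rewrite divr_ge0 ?mulr_ge0// ltW.
exists (c * 2) => [|y]; first by rewrite mulr_ge0.
have [->|yn0] := eqVneq y 0; first by rewrite N0 normr0 mulr0.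
have ny : 0 < `|y| by rewrite normr_gt0.
have eps0 k : 0 < `|y| * 2^-1 ^+ k.+1.
  by rewrite mulr_gt0// exprn_gt0// invr_gt0.
have ex_app (zk : Y * nat) : exists z,
    N z <= c * `|zk.1| /\ `|zk.1 - z| < `|y| * 2^-1 ^+ zk.2.+1.
  by have [z Nz zy] := appr zk.1 _ (eps0 zk.2); exists z.
have [app appP] := choice ex_app.
pose rem := fix rem k := if k is l.+1 then rem l - app (rem l, l) else y.
pose v k := app (rem k, k).
have rem_le k : `|rem k| <= `|y| * 2^-1 ^+ k.
  case: k => [|k] /=; first by rewrite expr0 mulr1.
  by have [_ /ltW] := appP (rem k, k).
have sumv m : series v m = y - rem m.
  rewrite /series /=; elim: m => [|m IH]; first by rewrite big_nil subrr.
  by rewrite big_nat_recr//= IH opprB addrCA addrC.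
apply: Nsub (v) _ _ _ _.
  rewrite (_ : series v = fun m => y - rem m); last exact/funext.
  rewrite -[X in _ --> X]subr0; apply: cvgB; first exact: cvg_cst.
  apply/norm_cvg0P.
  apply: (@squeeze_cvgr _ _ _ _ (fun=> 0) (geometric `|y| 2^-1)).
  - by apply: nearW => k; rewrite normr_ge0 rem_le.
  - exact: cvg_cst.
  - by apply: cvg_geometric; rewrite ger0_norm ?invr_ge0// invf_lt1// ltr1n.
move=> m; suff : \sum_(0 <= k < m) N (v k) <= c * 2 * `|y| * (1 - 2^-1 ^+ m).
  move/le_trans; apply; apply: ler_piMr; first by do 2?apply: mulr_ge0.
  by rewrite gerBl exprn_ge0// invr_ge0.
elim: m => [|m IH]; first by rewrite big_nil expr0 subrr mulr0.
rewrite big_nat_recr//=; have [Nv _] := appP (rem m, m).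
have := ler_wpM2l c0 (rem_le m).
rewrite exprS; move: IH Nv; rewrite /v /=; set q := 2^-1 ^+ m; lra.
Qed.

End countably_subadditive_seminorms.

(** * Projections of an unconditional sum *)

Section unconditional_projections.
Context {R : realType} {Y : completeNormedModType R}.
Variable X_ : nat -> closedSubspace Y.
Hypothesis H : unconditional_sum X_.

Lemma ex_components : exists pr : Y -> nat -> Y, forall y,
  [/\ forall n, csub_set (X_ n) (pr y n), series (pr y) @ \oo --> y &
    forall x, (forall n, csub_set (X_ n) (x n)) -> series x @ \oo --> y ->
      pr y = x].
Proof.
have ex (y : Y) : exists f : nat -> Y, [/\ forall n, csub_set (X_ n) (f n),
    series f @ \oo --> y & forall x, (forall n, csub_set (X_ n) (x n)) ->
    series x @ \oo --> y -> f = x].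
  have [x [[x1 x2] xu]] := H.1 y; exists x; split=> // z z1 z2.
  exact: xu.
by have [pr prP] := choice ex; exists pr.
Qed.

Lemma csub_set0 n : csub_set (X_ n) 0.
Proof. exact/set_mem/(csub_submod (X_ n)).1. Qed.

Lemma csub_setP n a x y :
  csub_set (X_ n) x -> csub_set (X_ n) y -> csub_set (X_ n) (a *: x + y).
Proof.
by move=> xX yX; apply/set_mem/(csub_submod (X_ n)).2; exact/mem_set.
Qed.

Section fixed_components.
Variable pr : Y -> nat -> Y.
Hypothesis prP : forall y,
  [/\ forall n, csub_set (X_ n) (pr y n), series (pr y) @ \oo --> y &
    forall x, (forall n, csub_set (X_ n) (x n)) -> series x @ \oo --> y ->
      pr y = x].

Lemma component_in y n : csub_set (X_ n) (pr y n).
Proof. by have [] := prP y. Qed.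

Lemma series_components y : series (pr y) @ \oo --> y.
Proof. by have [] := prP y. Qed.

Lemma components_unique y x : (forall n, csub_set (X_ n) (x n)) ->
  series x @ \oo --> y -> pr y = x.
Proof. by have [_ _] := prP y; exact. Qed.

Lemma components_linear n : linear (fun y => pr y n).
Proof.
move=> a y z; rewrite (@components_unique _ (fun i => a *: pr y i + pr z i))//.
  by move=> i; apply: csub_setP; exact: component_in.
rewrite (_ : series _ = (fun i => a *: series (pr y) i + series (pr z) i)).
  apply: cvgD; last exact: series_components.
  by apply: cvgZr; exact: series_components.
by apply/funext => i; rewrite /series /= scaler_sumr big_split.
Qed.

Definition partial (A : pred nat) m y := \sum_(0 <= i < m | A i) pr y i.

Lemma partial_linear A m : linear (partial A m).
Proof.
move=> a y z; rewrite /partial scaler_sumr -big_split /=.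
by apply: eq_bigr => i _; exact: components_linear.
Qed.

Lemma partialB A m y z : partial A m (y - z) = partial A m y - partial A m z.
Proof.
have := partial_linear A m (-1) z y.
by rewrite !scaleN1r [- z + y]addrC [- partial A m z + _]addrC.
Qed.

Definition supnorm y := sup [set r | exists A m, r = `|partial A m y|].

Lemma partial_le A m y : `|partial A m y| <= supnorm y.
Proof.
apply: ub_le_sup; last by exists A, m.
have cpr : cvgn (series (pr y)) by apply: cvgP; exact: series_components.
have [M hM] := unconditionally_cvg_bounded (H.2 _ (component_in y) cpr).
by exists M => _ [B [k ->]]; exact: hM.
Qed.

Lemma supnorm_le y M : (forall A m, `|partial A m y| <= M) -> supnorm y <= M.
Proof.
move=> h; apply: ge_sup; first by exists `|partial xpred0 0 y|, xpred0, 0%N.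
by move=> _ [A [m ->]].
Qed.

Lemma supnorm_ge0 y : 0 <= supnorm y.
Proof. exact: le_trans (normr_ge0 _) (partial_le xpredT 0 y). Qed.

Lemma supnormD y z : supnorm (y + z) <= supnorm y + supnorm z.
Proof.
apply: supnorm_le => A m.
have := partial_linear A m 1 y z; rewrite !scale1r => ->.
by apply: le_trans (ler_normD _ _) _; apply: lerD; exact: partial_le.
Qed.

Lemma supnormZ t y : supnorm (t *: y) = `|t| * supnorm y.
Proof.
have le s z : supnorm (s *: z) <= `|s| * supnorm z.
  apply: supnorm_le => A m; have := partial_linear A m s z (0 : Y).
  rewrite addr0 => ->; have := partialB A m 0 0; rewrite !subrr => ->.
  by rewrite addr0 normrZ ler_wpM2l// partial_le.
apply/eqP; rewrite eq_le le /=; have [->|t0] := eqVneq t 0.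
  by rewrite normr0 mul0r supnorm_ge0.
rewrite -ler_pdivlMl ?normr_gt0// -normfV; apply: le_trans (le _ _).
by rewrite scalerA mulVf// scale1r.
Qed.

Lemma norm_component_le y i : `|pr y i| <= supnorm y.
Proof.
have := partial_le (pred1 i) i.+1 y.
rewrite /partial big_mkcond big_nat_recr//= eqxx big_nat.
rewrite big1 ?add0r// => j /andP[_ ji].
by rewrite ltn_eqF.
Qed.

(** If the values of [supnorm] on the terms of a convergent series are
    summable, then the components can be summed term by term: the limits are
    uniform in the set of components, so they again represent the sum. *)
Lemma supnorm_series (v : nat -> Y) y M : series v @ \oo --> y ->
  (forall m, \sum_(0 <= k < m) supnorm (v k) <= M) -> supnorm y <= M.
Proof.
move=> vy vM; pose a m := \sum_(0 <= k < m) supnorm (v k).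
have nda : nondecreasing_seq a.
  apply/nondecreasing_seqP => m.
  by rewrite /a big_nat_recr//= lerDl supnorm_ge0.
have ca : cvgn a.
  apply: nondecreasing_is_cvgn => //.
  by exists M => _ [m _ <-]; exact: vM.
pose L := limn a.
have aL m : a m <= L by exact: nondecreasing_cvgn_le.
have LM : L <= M by apply: limr_le => //; exact: nearW.
pose s := series v.
have sB m l : (m <= l)%N -> supnorm (s l - s m) <= L - a m.
  move=> ml; apply: le_trans (_ : _ <= a l - a m) _; last by rewrite lerB.
  rewrite /s /series /a /= !(big_cat_nat (leq0n m) ml) /=.
  rewrite [X in supnorm X]addrC addKr [leRHS]addrC addKr.
  elim: l ml => [|k IH].
    rewrite leqn0 => /eqP ->.
    by rewrite !big_nil -(scale0r 0) supnormZ normr0 mul0r.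
  rewrite leq_eqVlt ltnS => /predU1P[->|mk].
    by rewrite !big_geq// -(scale0r 0) supnormZ normr0 mul0r.
  rewrite !big_nat_recr//=; apply: le_trans (supnormD _ _) _.
  by rewrite lerD2r IH.
pose x i := limn (series (fun k => pr (v k) i)).
have prs m i : pr (s m) i = series (fun k => pr (v k) i) m.
  rewrite /s /series /=; elim: m => [|m IH].
    have := components_linear i (-1) 0 0.
    by rewrite !big_nil scaler0 addr0 scaleN1r addNr.
  rewrite !big_nat_recr//= -IH.
  have := components_linear i 1 (\sum_(0 <= k < m) v k) (v m).
  by rewrite !scale1r.
have cx i : pr (s m) i @[m --> \oo] --> x i.
  rewrite (_ : (fun m => _) = series (fun k => pr (v k) i)); last first.
    by apply/funext => m; exact: prs.
  apply: normed_cvg; apply: (series_le_cvg _ _ _ ca) => k //=.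
    exact: supnorm_ge0.
  exact: norm_component_le.
have tail A n m : `|\sum_(0 <= i < n | A i) x i - partial A n (s m)| <= L - a m.
  have cA : `|partial A n (s l) - partial A n (s m)| @[l --> \oo] -->
      `|\sum_(0 <= i < n | A i) x i - partial A n (s m)|.
    apply: cvg_norm; apply: cvgB; last exact: cvg_cst.
    rewrite /partial; apply: cvg_big => [|i _]; first exact: add_continuous.
    exact: cx.
  apply: cvgr_to_le cA _; exists m => // l /= ml.
  by rewrite -partialB; apply: le_trans (partial_le _ _ _) (sB _ _ ml).
have xX i : csub_set (X_ i) (x i).
  have near_in : \forall m \near \oo, csub_set (X_ i) (pr (s m) i).
    by apply: nearW => m; exact: component_in.
  exact: (@closed_cvg _ _ _ _ _ _ (@csub_closed _ _ (X_ i)) near_in _ (cx i)).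
have sumx : series x @ \oo --> y.
  apply/cvgrPdist_lt => e e0; have e30 : 0 < e / 3 by rewrite divr_gt0.
  have sy : s @ \oo --> y by [].
  have [m1 _ m1P] := proj1 (cvgrPdist_lt _ _) sy _ e30.
  have [m2 _ m2P] := proj1 (cvgrPdist_lt _ _) ca _ e30.
  pose m := maxn m1 m2.
  have yM : `|y - s m| < e / 3 by apply: m1P; exact: leq_maxl.
  have LM' : L - a m < e / 3.
    by apply: le_lt_trans (ler_norm _) (m2P _ _); exact: leq_maxr.
  have [m3 _ m3P] := proj1 (cvgrPdist_lt _ _) (@series_components (s m)) _ e30.
  exists m3 => // n m3n; have sn := m3P _ m3n; rewrite /= in sn *.
  have := tail predT n m; rewrite distrC => tn.
  have -> : y - series x n = (y - s m) + (s m - series (pr (s m)) n) +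
    (partial predT n (s m) - series x n).
    by rewrite -!addrA !addKr.
  apply: le_lt_trans (ler_normD _ _) _.
  by have := ler_normD (y - s m) (s m - series (pr (s m)) n); lra.
have prx := components_unique xX sumx.
apply: supnorm_le => A n; apply: le_trans (_ : _ <= L) LM.
have := tail A n 0%N; rewrite /a big_nil subr0 /partial -prx.
rewrite [X in _ - X]big1 ?subr0// => i _.
by rewrite prs /series /= big_nil.
Qed.

Lemma component_truncation n y i :
  pr (\sum_(0 <= j < n) pr y j) i = if (i < n)%N then pr y i else 0.
Proof.
rewrite (@components_unique _ (fun i => if (i < n)%N then pr y i else 0))//.
  by move=> k; case: ifP => _; [exact: component_in|exact: csub_set0].
apply: cvg_near_cst; exists n => // m /= nm.
rewrite /series /= (big_cat_nat (leq0n n) nm) /= [X in _ + X]big_nat.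
rewrite [X in _ + X]big1 ?addr0; last first.
  by move=> k /andP[nk _]; rewrite ltnNge nk.
by rewrite big_nat [RHS]big_nat; apply: eq_bigr => k /= ->.
Qed.

End fixed_components.

(** Uniform boundedness of the projections onto finite sets of components is
    Zabreiko's lemma applied to the supremum of their norms. *)
Lemma ex_projections : exists (P : nat -> {linear Y -> Y}) (C : R),
  [/\ forall n y, csub_set (X_ n) (P n y),
    forall y, series (P^~ y) @ \oo --> y,
    forall n y i,
      P i (\sum_(0 <= j < n) P j y) = if (i < n)%N then P i y else 0,
    0 <= C &
    forall (A : pred nat) m y, `|\sum_(0 <= i < m | A i) P i y| <= C * `|y|].
Proof.
have [pr prP] := ex_components.
have [C C0 hC] :=
  zabreiko (supnormD prP) (supnormZ prP) (supnorm_series prP).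
pose P i : {linear Y -> Y} :=
  HB.pack (fun y => pr y i)
    (GRing.isLinear.Build _ _ _ _ _ (components_linear prP i)).
exists P, C; split=> //.
- by move=> n y; exact: component_in.
- by move=> y; exact: (series_components prP).
- by move=> n y i; exact: (component_truncation prP).
- by move=> A m y; apply: le_trans (partial_le prP A m y) (hC y).
Qed.

End unconditional_projections.

(** * Operators into reflexive subspaces *)

Section reflexive_ranges.
Context {R : realType}.

Lemma ultra_bounded_cvg (U : set_system nat) (a : nat -> R) M :
  UltraFilter U -> (forall k, `|a k| <= M) -> exists l : R, a @ U --> l.
Proof.
move=> UU aM; have UT : U (a @^-1` `[- M, M]%classic).
  apply: filterS filterT => k _.
  by rewrite /= in_itv /= -ler_norml aM.
have [l [_ al]] := @segment_compact R (- M) M (a @ U) _ UT.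
exists l => B lB; have [//|aB] := in_ultra_setVsetC (a @^-1` B) UU.
by have [t []] := al (~` B) B aB lB.
Qed.

Context {X Y : normedModType R}.

(** The limits of [f (T (z k))], for [f] in the dual of the range, define a
    bounded functional on that dual; reflexivity represents it by a point. *)
Lemma weakly_compact_reflexive (V : closedSubspace Y) (T : X -> Y) M :
  reflexive_space (csub V) -> (forall x, csub_set V (T x)) ->
  (forall x, `|T x| <= M * `|x|) -> weakly_compact T.
Proof.
move=> rV TV TM U z UU z1.
have M0 k : `|T (z k)| <= `|M|.
  apply: le_trans (TM _) _; apply: le_trans (_ : _ <= `|M| * `|z k|) _.
    by rewrite ler_wpM2r// ler_norm.
  by rewrite ler_piMr.
pose v k : csub V := CSub (mem_set (TV (z k))).
have bnd (f : dual (csub V)) k : `|f (v k)| <= `|M| * `|f|.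
  apply: le_trans (ler_opnorm _ (@dual_continuous _ _ f)) _.
  by rewrite mulrC; apply: ler_wpM2r; [exact: (normr_ge0 f)|exact: M0].
have ex (f : dual (csub V)) : exists l : R, f (v k) @[k --> U] --> l.
  exact: ultra_bounded_cvg (bnd f).
have [Phi PhiP] := choice ex.
have lPhi : linear (Phi : _ -> R^o).
  move=> a f g; apply: (@cvg_unique _ (@Rhausdorff R) _ _ _ _ (PhiP _)).
  by apply: cvgD; [apply: cvgMl_tmp; exact: PhiP|exact: PhiP].
pose Psi : {linear dual (csub V) -> R^o} :=
  HB.pack (Phi : _ -> R^o) (GRing.isLinear.Build _ _ _ _ _ lPhi).
have cPsi : continuous Psi.
  apply: (linear_continuous_bound (M := `|M|)) => f.
  apply: cvgr_to_le (cvg_norm (PhiP f)) _.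
  by apply: nearW => k; exact: bnd.
have PsiP : (Psi : dual (csub V) -> R^o) \in @dual_pred R (dual (csub V)).
  by apply/mem_set; split=> //; exact: lPhi.
have [p _ pPsi] : range (@to_bidual R (csub V)) (Dual PsiP) by rewrite rV.
exists (val p) => g gc.
have cg : continuous (fun w : csub V => g (val w) : R^o).
  pose h : {linear csub V -> R^o} := g \o val.
  apply: (@linear_continuous_bound _ _ _ h 1) => w.
  by rewrite mul1r; exact: gc.
have hP : (fun w : csub V => g (val w) : R^o) \in @dual_pred R (csub V).
  by apply/mem_set; split=> // a u w; rewrite /= linearP.
have := PhiP (Dual hP).
by have /(congr1 (fun F : dual (dual (csub V)) => F (Dual hP))) /= <- := pPsi.
Qed.

Lemma weakly_compact_sum (T : nat -> X -> Y) n :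
  (forall i, weakly_compact (T i)) ->
  weakly_compact (fun x => \sum_(0 <= i < n) T i x).
Proof.
move=> wT U z UU z1.
have [p pP] := choice (fun i => wT i U z UU z1).
exists (\sum_(0 <= i < n) p i) => g gc; rewrite raddf_sum.
under eq_cvg do rewrite raddf_sum.
apply: cvg_big => [|i _]; first exact: add_continuous.
exact: pP.
Qed.

End reflexive_ranges.

(** * The gliding hump *)

Section embedding.
Context {R : realType} {X : normedModType R} {Y : completeNormedModType R}.
Hypotheses (X0 : exists x : X, x != 0) (dX : Daugavet X).
Hypothesis sX : separable_space X.
Variable X_ : nat -> closedSubspace Y.
Hypotheses (H : unconditional_sum X_).
Hypothesis rX : forall n, reflexive_space (csub (X_ n)).
Variables (J : {linear X -> Y}) (c M : R).
Hypotheses (c0 : 0 < c) (Jc : forall x, c * `|x| <= `|J x|).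
Hypothesis JM : forall x, `|J x| <= M * `|x|.

(** In a chain of points of the unit ball, each almost additive over what
    precedes it, the sum [s] of every second increment grows linearly with the
    number of steps.  The images of the increments can be made almost disjoint
    blocks of the sum, so [J s] is nearly the projection, onto the blocks in
    [A], of the image of the total increment [y - y0], which is bounded. *)
Lemma no_unconditional_embedding : False.
Proof.
have [P [C [PX Pcvg Ptrunc C0 PC]]] := ex_projections H.
pose pt (A : pred nat) m w := \sum_(0 <= i < m | A i) P i w.
have lpt A m : linear (pt A m).
  move=> a v w; rewrite /pt scaler_sumr -big_split /=.
  by apply: eq_bigr => i _; rewrite linearP.
pose Q (A : pred nat) m : {linear Y -> Y} :=
  HB.pack (pt A m) (GRing.isLinear.Build _ _ _ _ _ (lpt A m)).
have QE A m w : Q A m w = \sum_(0 <= i < m | A i) P i w by [].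
have QD A m v w : Q A m (v + w) = Q A m v + Q A m w by exact: raddfD.
have QC A m w : `|Q A m w| <= C * `|w| by exact: PC.
have Qnest A n m w : (n <= m)%N -> Q A n w = Q A n (Q predT m w).
  move=> nm; rewrite !QE big_nat_cond [RHS]big_nat_cond.
  apply: eq_bigr => i /andP[/andP[_ ni] _].
  by rewrite Ptrunc (leq_trans ni nm).
have Qsmall A n m w e : (n <= m)%N -> `|Q predT m w| <= e ->
    `|Q A n w| <= C * e.
  move=> nm we; rewrite (Qnest _ _ _ _ nm); apply: le_trans (QC _ _ _) _.
  exact: ler_wpM2l.
have Qtail w e : 0 < e ->
    exists m, forall n, (m <= n)%N -> `|w - Q predT n w| <= e.
  move=> e0; have [m _ mP] := proj1 (cvgrPdist_lt _ _) (Pcvg w) _ e0.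
  by exists m => n mn; apply: ltW; exact: mP.
have narrow n y u e : `|y| <= 1 -> 0 < e -> exists z, [/\ `|z| <= 1,
    almost_additive e u z & `|Q predT n (J (z - y))| <= e].
  move=> y1 e0; pose T : {linear X -> Y} := Q predT n \o J.
  have wT : weakly_compact T.
    apply: (@weakly_compact_sum _ _ _ (fun i x => P i (J x))) => i.
    apply: (weakly_compact_reflexive (M := C * M)) (rX i) _ _ => x.
      exact: PX.
    have := PC (pred1 i) i.+1 (J x); rewrite big_mkcond big_nat_recr//= eqxx.
    rewrite big_nat big1 ?add0r => [|j /andP[_ ji]]; last by rewrite ltn_eqF.
    by move/le_trans; apply; rewrite -mulrA ler_wpM2l.
  have cT : continuous T.
    apply: (linear_continuous_bound (M := C * M)) => x.
    by apply: le_trans (QC _ _ _) _; rewrite -mulrA ler_wpM2l.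
  have [z [z1 uz Tzy]] := weakly_compact_narrow X0 dX sX cT wT y1 u e0.
  by exists z; split=> //; rewrite !raddfB /=; exact: ltW.
have steps k e : 0 < e -> exists y0 y s A n, [/\ `|y0| <= 1, `|y| <= 1,
    k%:R <= `|s| & `|Q A n (J (y - y0)) - J s| <= k%:R * e].
  move=> e0; elim: k => [|k [y0 [y [s [A [n [y01 y1 sk As]]]]]]].
    exists 0, 0, 0, pred0, 0%N; rewrite normr0 subr0 !raddf0.
    by rewrite addr0 normr0 mul0r ler01 lexx.
  pose d := Num.min (1 / 2) (e / (2 * C + 4)).
  have C4 : 0 < 2 * C + 4 by lra.
  have d0 : 0 < d by rewrite lt_min !divr_gt0.
  have [d2 dC] : d <= 1 / 2 /\ d * (2 * C + 4) <= e.
    by rewrite -ler_pdivlMr// /d !ge_min !lexx orbT.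
  (* the increment z - y is left out of s, and its image is small on A *)
  have [z [z1 sz zy]] := narrow n y (- s) d y1 d0.
  (* from n1 on the image of the path so far is negligible; the next increment
     is the one retained in s, and its image lives between n1 and n2 *)
  have [m1 m1P] := Qtail (J (z - y0)) d d0.
  pose n1 := maxn n m1; have nn1 : (n <= n1)%N := leq_maxl _ _.
  have m1n1 : (m1 <= n1)%N := leq_maxr _ _.
  have [v [v1 sv vz]] := narrow n1 z (s - z) d z1 d0.
  have [m2 m2P] := Qtail (J (v - z)) d d0.
  pose n2 := maxn n1 m2; have n1n2 : (n1 <= n2)%N := leq_maxl _ _.
  pose B i := (A i && (i < n)%N) || (n1 <= i)%N.
  have QB w : Q B n2 w = Q A n w + (Q predT n2 w - Q predT n1 w).
    rewrite !QE !(big_cat_nat (leq0n n1) n1n2) /=.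
    rewrite [X in _ + (X - _)]addrC addrK (big_cat_nat (leq0n n) nn1) /=.
    congr (_ + _); last first.
      rewrite big_nat_cond [RHS]big_nat_cond; apply: eq_bigl => i.
      by rewrite /B; case: (n1 <= i)%N; rewrite ?orbT ?andbF.
    rewrite [X in _ + X]big_nat_cond.
    rewrite [X in _ + X]big1 ?addr0 => [|i]; last first.
      case/andP => /andP[ni n1i]; rewrite /B ltnNge ni andbF /= leqNgt n1i.
      by [].
    rewrite big_nat_cond [RHS]big_nat_cond; apply: eq_bigl => i.
    rewrite /B; have [ni|//] := ltnP i n; rewrite ?andbF//= andbT.
    by rewrite [(n1 <= i)%N]leqNgt (leq_trans ni nn1) orbF.
  exists y0, v, (s + (v - z)), B, n2; split=> //.
    move: sz sv; rewrite /almost_additive normrN [- s + z]addrC distrC.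
    by rewrite -[s - z + v]addrA [- z + v]addrC -natr1; lra.
  have -> : v - y0 = (z - y0) + (v - z) by rewrite [RHS]addrC addrA subrK.
  have -> : J (z - y0 + (v - z)) = J (z - y0) + J (v - z) by exact: raddfD.
  rewrite QB.
  have zE : z - y0 = (y - y0) + (z - y) by rewrite [RHS]addrC addrA subrK.
  have e1 : `|Q A n (J (z - y))| <= C * d := Qsmall _ _ _ _ _ (leqnn n) zy.
  have e2 : `|Q A n (J (v - z))| <= C * d := Qsmall _ _ _ _ _ nn1 vz.
  have e3 : `|J (z - y0) - Q predT n2 (J (z - y0))| <= d.
    exact: m1P (leq_trans m1n1 n1n2).
  have e4 : `|J (z - y0) - Q predT n1 (J (z - y0))| <= d by exact: m1P.
  have e5 : `|J (v - z) - Q predT n2 (J (v - z))| <= d.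
    by apply: m2P; exact: leq_maxr.
  set a := J (y - y0) in As; set b := J (z - y) in e1.
  have ab : J (z - y0) = a + b by rewrite zE raddfD.
  set w := J (z - y0) in ab e3 e4 *; set x := J (v - z) in vz e2 e5 *.
  have -> : Q A n (w + x) + (Q predT n2 (w + x) - Q predT n1 (w + x)) -
      J (s + (v - z)) = (Q A n a - J s) + Q A n b + Q A n x +
      (w - Q predT n1 w) - (w - Q predT n2 w) - (x - Q predT n2 x) -
      Q predT n1 x.
    have -> : J (s + (v - z)) = J s + x by exact: raddfD.
    have aE : Q A n w = Q A n a + Q A n b by rewrite ab QD.
    rewrite !QD aE.
    rewrite !opprD !opprK !addrA.
    by rewrite [RHS](ACl (5*7*1*3*4*8*10*6*11*2*9)) /= subrr add0r.
  have tri (p q : Y) r t : `|p| <= r -> `|q| <= t -> `|p + q| <= r + t.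
    by move=> pr qt; apply: le_trans (ler_normD _ _) (lerD pr qt).
  have triB (p q : Y) r t : `|p| <= r -> `|q| <= t -> `|p - q| <= r + t.
    by move=> pr qt; apply: tri; rewrite ?normrN.
  have := triB _ _ _ _ (triB _ _ _ _ (triB _ _ _ _ (tri _ _ _ _ (tri _ _ _ _
    (tri _ _ _ _ As e1) e2) e4) e3) e5) vz.
  by move/le_trans; apply; rewrite -natr1; lra.
have M0 : 0 <= M.
  have [x x0] := X0; have := le_trans (normr_ge0 _) (JM x).
  by rewrite pmulr_lge0// normr_gt0.
pose K := 2 * (C * M).
have [k kK] : exists k : nat, 2 * K / c < k%:R.
  exists (Num.bound `|2 * K / c|).
  exact: le_lt_trans (ler_norm _) (archi_boundP (normr_ge0 _)).
have c20 : 0 < c / 2 by rewrite divr_gt0.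
have [y0 [y [s [A [n [y01 y1 sk As]]]]]] := steps k _ c20.
have sJ := Jc s.
have QJ : `|Q A n (J (y - y0))| <= K.
  apply: le_trans (QC _ _ _) _; rewrite /K mulrCA; apply: ler_wpM2l => //.
  apply: le_trans (JM _) _; rewrite [2 * M]mulrC; apply: ler_wpM2l => //.
  by apply: le_trans (ler_normB _ _) _; lra.
have Js : `|J s| <= `|Q A n (J (y - y0))| + `|Q A n (J (y - y0)) - J s|.
  by rewrite -[in leLHS](subKr (Q A n (J (y - y0))) (J s)) ler_normB.
have ck : c * k%:R <= c * `|s| by rewrite ler_wpM2l// ltW.
move: kK; rewrite ltr_pdivrMr//; lra.
Qed.

End embedding.

(** * Unconditional bases and embeddings *)

Section lines.
Context {R : realType} {Y : completeNormedModType R} (e : Y).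
Hypothesis e0 : e != 0.

Definition line : set Y := [set a *: e | a in [set: R]].

Lemma line_submod_closed : submod_closed (mem line).
Proof.
split=> [|a _ _ /set_mem[b _ <-] /set_mem[c _ <-]].
  by apply/mem_set; exists 0; rewrite ?scale0r.
by apply/mem_set; exists (a * b + c); rewrite // scalerDl scalerA.
Qed.

(** A bounded part of the line is compact, and a limit of points of the line
    is a limit of points of such a part. *)
Lemma line_closed : closed line.
Proof.
move=> y ly; pose M := (`|y| + 1) / `|e|.
have ne : 0 < `|e| by rewrite normr_gt0.
have cK : compact [set a *: e | a in `[- M, M]].
  apply: continuous_compact; last exact: segment_compact.
  by apply: continuous_subspaceT => a; apply: cvgZr_tmp; exact: cvg_id.
have clK : closed [set a *: e | a in `[- M, M]].
  by apply: compact_closed => //; exact: norm_hausdorff.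
suff /clK[a _ <-] : closure [set a *: e | a in `[- M, M]] y by exists a.
move=> B yB; have yB1 : nbhs y (B `&` ball y 1).
  by apply: filterI => //; exact: nbhsx_ballx.
have [_ [[a _ <-] [Ba ya]]] := ly _ yB1.
exists (a *: e); split=> //; exists a => //=.
rewrite in_itv /= -ler_norml /M ler_pdivlMr// -normrZ.
move: ya; rewrite -ball_normE /= => ya.
have : `|a *: e| <= `|y| + `|y - a *: e|.
  by rewrite -[in leLHS](subKr y (a *: e)) ler_normB.
by lra.
Qed.

Definition line_subspace := ClosedSubspace line_submod_closed line_closed.

(** Functionals on the line are multiples of the coordinate [f0], so a bidual
    element is determined by its value at [f0]. *)
Lemma line_reflexive : reflexive_space (csub line_subspace).
Proof.
pose V := csub line_subspace.
have eV : e \in csub_pred line_subspace.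
  by apply/mem_set; exists 1; rewrite ?scale1r.
pose u : V := CSub eV.
have exc (v : V) : exists a, v = a *: u.
  have /set_mem[a _ av] := csub_valP v.
  by exists a; apply: val_inj.
have [coord coordP] := choice exc.
have nu : 0 < `|u| by rewrite csub_normE normr_gt0.
have lc : linear (coord : V -> R^o).
  move=> a v w; apply/eqP; rewrite -subr_eq0.
  suff : (coord (a *: v + w) - (a * coord v + coord w)) *: u = 0.
    by move/eqP; rewrite scaler_eq0 -[u == 0]normr_eq0 (gt_eqF nu) orbF.
  rewrite scalerBl scalerDl -scalerA -!coordP; exact: subrr.
pose h : {linear V -> R^o} :=
  HB.pack (coord : V -> R^o) (GRing.isLinear.Build _ _ _ _ _ lc).
have ch : continuous h.
  apply: (linear_continuous_bound (M := `|u|^-1)) => v.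
  by rewrite [in leRHS](coordP v) normrZ mulrC mulfK ?gt_eqF.
have hP : (coord : V -> R^o) \in @dual_pred R V by apply/mem_set.
pose f0 : dual V := Dual hP.
apply/seteqP; split=> // Phi _; exists (Phi f0 *: u) => //.
apply: val_inj; apply/funext => f /=.
have fE : f = (f u : R) *: f0.
  apply: val_inj; apply/funext => v /=.
  rewrite {1}(coordP v) linearZ /=; exact: mulrC.
rewrite [in RHS]fE !linearZ /=; exact: mulrC.
Qed.

End lines.

Section bases_and_embeddings.
Context {R : realType}.

Lemma basis_neq0 (Y : completeNormedModType R) (e : nat -> Y) n :
  unconditional_basis e -> e n != 0.
Proof.
move=> [eb _]; apply/eqP => en; have [a [_ a_unique]] := eb 0.
have cvg0 b : (forall i, b i *: e i = 0) ->
    series (fun i => b i *: e i) @ \oo --> (0 : Y).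
  move=> b0; rewrite (_ : series _ = fun=> 0); first exact: cvg_cst.
  by apply/funext => m; rewrite /series /= big1.
have := a_unique (fun=> 0) (cvg0 _ (fun i => scale0r _)).
have -> := a_unique (fun i => (i == n)%:R) (cvg0 _ _).
  by move/(congr1 (@^~ n)) => /eqP; rewrite eqxx oner_eq0.
by move=> i; case: eqP => [->|_]; rewrite ?en ?scaler0 ?scale0r.
Qed.

Lemma unconditional_sum_lines (Y : completeNormedModType R) (e : nat -> Y)
    (be : unconditional_basis e) :
  unconditional_sum (fun n => line_subspace (basis_neq0 n be)).
Proof.
have coef (x : nat -> Y) : (forall n, line (e n) (x n)) ->
    exists a : nat -> R, x = (fun n => a n *: e n).
  move=> xl; have [a aP] := choice (fun n => let: ex_intro2 a _ ax := xl n in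
    ex_intro (fun a => a *: e n = x n) a ax).
  by exists a; apply/funext => n.
split=> [y|x /coef[a ->]]; last exact: be.2.
have [a [ay au]] := be.1 y; exists (fun n => a n *: e n); split.
  by split=> // n; exists (a n).
by move=> _ [/coef[b ->] by_]; rewrite (au b by_).
Qed.

Lemma embeds_bounds (X : normedModType R) (Y : completeNormedModType R) :
  embeds X Y -> exists (J : {linear X -> Y}) (c M : R), [/\ 0 < c,
    forall x, c * `|x| <= `|J x| & forall x, `|J x| <= M * `|x|].
Proof.
move=> [V [T [S [TS _ cT cS]]]].
pose J : {linear X -> Y} := val \o T.
exists J, (`|opnorm S| + 1)^-1, (opnorm T).
have c0 : 0 < `|opnorm S| + 1 by rewrite ltr_wpDl.
split=> [|x|x]; first by rewrite invr_gt0.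
  rewrite mulrC ler_pdivrMr// -{1}(TS x); apply: le_trans (ler_opnorm _ cS) _.
  rewrite mulrC; apply: ler_wpM2l => //.
  by apply: le_trans (ler_norm _) _; rewrite lerDl.
exact: ler_opnorm cT.
Qed.

End bases_and_embeddings.
Unset Implicit Arguments.

Theorem corollary2p7 (R : realType) (X : completeNormedModType R)
    (X_nonzero : exists x : X, x != 0)
    (X_separable : separable_space X)
    (X_Daugavet : Daugavet X) :
  (forall (Y : completeNormedModType R) (X_ : nat -> closedSubspace Y),
     unconditional_sum X_ -> (forall n, reflexive_space (csub (X_ n))) ->
     ~ embeds X Y) /\
  (forall (Y : completeNormedModType R) (e : nat -> Y),
     unconditional_basis e -> ~ embeds X Y).
Proof.
have main (Y : completeNormedModType R) (X_ : nat -> closedSubspace Y) :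
    unconditional_sum X_ -> (forall n, reflexive_space (csub (X_ n))) ->
    ~ embeds X Y.
  move=> XS Xr /embeds_bounds[J [c [M [c0 Jc JM]]]].
  exact: (no_unconditional_embedding X_nonzero X_Daugavet X_separable XS Xr
    c0 Jc JM).
split=> // Y e be; apply: (main _ _ (unconditional_sum_lines be)) => n.
exact: line_reflexive.
Qed.
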